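(* Let $N\geq 2$, $k\in\mathbb{R}$, $\sigma\in\mathbb{R}$. Assume that $f\in L^1(\partial B_1)$ and $I_f:=\int_{\partial B_1} f(x)\,dS_x>0$. If $\alpha=0$, $\sigma>-2$ and $k>2-N$, then for $$p=1+\frac{\sigma+2}{N+k-2}:$$ (i) the problem consisting of the inequality $\partial_t u-\Delta u-k\frac{x}{|x|^2}\cdot\nabla u\geq t^\alpha|x|^\sigma|u|^p$ (with $\alpha=0$) in $(0,\infty)\times B_1^c$ under the Neumann-type boundary condition $\frac{\partial u}{\partial\nu}(t,x)\geq f(x)$ on $(0,\infty)\times\partial B_1$ admits no global weak solution; (ii) the problem consisting of the same inequality under the Dirichlet-type boundary condition $u(t,x)\geq f(x)$ on $(0,\infty)\times\partial B_1$ admits no global weak solution.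
   Context: $B_1$ is the open unit ball centered at the origin of $\mathbb{R}^N$, $B_1^c$ is its complement in $\mathbb{R}^N$ (a closed set), $\nu$ is the outward unit normal on $\partial B_1$ relative to $B_1^c$ (so $\nu(x)=-x$). Put $\Omega=(0,\infty)\times B_1^c$ and $\Gamma=(0,\infty)\times\partial B_1$; note $\Gamma\subset\Omega$. Solutions are real-valued and may change sign. The notation $\mathrm{supp}(\varphi)\subset\subset\Omega$ means that the support is a compact subset of $\Omega$ (it may meet $\Gamma$). $C^{1,2}_{t,x}(\Omega)$ denotes functions that are $C^1$ in $t$ and $C^2$ in $x$ on $\Omega$. Neumann-type problem. Let $\Phi=\{\varphi\in C^{1,2}_{t,x}(\Omega):\ \varphi\geq 0,\ \mathrm{supp}(\varphi)\subset\subset\Omega,\ (\frac{\partial\varphi}{\partial\nu}+k\varphi)|_\Gamma=0\}$. A global weak solution of the inequality under the Neumann-type boundary condition is a function $u\in L^p_{loc}(\Omega)$ such that for every $\varphi\in\Phi$, $$\int_\Omega t^\alpha|x|^\sigma|u|^p\varphi\,dx\,dt+\int_\Gamma f\varphi\,dS_x\,dt\leq-\int_\Omega u\,\partial_t\varphi\,dx\,dt+\int_\Omega\left(-\Delta\varphi+k\,\mathrm{div}\left(\varphi\frac{x}{|x|^2}\right)\right)u\,dx\,dt.$$ Dirichlet-type problem. Let $\Psi=\{\psi\in C^{1,2}_{t,x}(\Omega):\ \psi\geq 0,\ \mathrm{supp}(\psi)\subset\subset\Omega,\ \psi|_\Gamma=0,\ \frac{\partial\psi}{\partial\nu}|_\Gamma\leq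 0\}$. A global weak solution of the inequality under the Dirichlet-type boundary condition is a function $u\in L^p_{loc}(\Omega)$ such that for every $\psi\in\Psi$, $$\int_\Omega t^\alpha|x|^\sigma|u|^p\psi\,dx\,dt-\int_\Gamma f\frac{\partial\psi}{\partial\nu}\,dS_x\,dt\leq-\int_\Omega u\,\partial_t\psi\,dx\,dt+\int_\Omega\left(-\Delta\psi+k\,\mathrm{div}\left(\psi\frac{x}{|x|^2}\right)\right)u\,dx\,dt.$$ *)

(* Defs.v *)
From HB Require Import structures.
From mathcomp Require Import all_boot all_order all_algebra.
From mathcomp Require Import all_classical all_reals all_analysis.
From mathcomp Require Import measurable_realfun.

Set Implicit Arguments.
Unset Strict Implicit.
Unset Printing Implicit Defensive.

Import Order.TTheory GRing.Theory Num.Theory.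
Import numFieldNormedType.Exports.

Local Open Scope classical_set_scope.
Local Open Scope ring_scope.

(* 'rV[R]_n models R^n; its sigma-algebra is the product of the Borel
   sigma-algebras of the coordinates, i.e. the Borel sigma-algebra of R^n. *)
Section row_vector_measurable.
Context {R : realType} (n : nat).

Let coord (i : 'I_n) (x : 'rV[R]_n) : R := x ord0 i.

Let rV_set0 : g_sigma_preimage coord set0.
Proof. exact: sigma_algebra0. Qed.

Let rV_setC A : g_sigma_preimage coord A -> g_sigma_preimage coord (~` A).
Proof. exact: sigma_algebraC. Qed.

Let rV_bigcup (F : _^nat) : (forall i, g_sigma_preimage coord (F i)) ->
  g_sigma_preimage coord (\bigcup_i (F i)).
Proof. exact: sigma_algebra_bigcup. Qed.

HB.instance Definition _ :=
  @isMeasurable.Build (measure_tuple_display default_measure_display)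
    'rV[R]_n (g_sigma_preimage coord) rV_set0 rV_setC rV_bigcup.

Lemma measurable_coord (i : 'I_n) :
  measurable_fun [set: 'rV[R]_n] (fun x => x ord0 i).
Proof.
move=> _ Y mY; rewrite setTI; apply: sub_sigma_algebra => /=.
rewrite -bigcup_seq/=; exists i => /=; first by rewrite mem_index_enum.
by exists Y => //; rewrite setTI.
Qed.

Lemma measurable_rVP d (T : measurableType d) (f : T -> 'rV[R]_n) :
  (forall i, measurable_fun [set: T] (fun t => f t ord0 i)) ->
  measurable_fun [set: T] f.
Proof.
move=> mf.
have prefS : g_sigma_preimage (fun i => coord i \o f) `<=` measurable.
  apply: smallest_sub; first exact: sigma_algebra_measurable.
  move=> A; rewrite -bigcup_seq => -[i _ [B mB <-]].
  exact: mf.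
move=> _ A mA; apply: prefS; rewrite g_sigma_preimage_comp.
by exists A.
Qed.

End row_vector_measurable.

Section lebesgue_rV.
Context {R : realType}.
Local Open Scope ereal_scope.

Definition cons_rV n (z : R * 'rV[R]_n) : 'rV[R]_n.+1 :=
  row_mx (const_mx z.1 : 'rV[R]_1) z.2.

Lemma measurable_cons_rV n : measurable_fun setT (@cons_rV n).
Proof.
apply: measurable_rVP => i.
have [j|j] := splitP (i : 'I_(1 + n)) => ij.
- rewrite [X in measurable_fun _ X](_ : _ = fst)//.
  apply/funext => z; rewrite /cons_rV.
  by rewrite (_ : i = lshift n j) ?(@row_mxEl R 1 1 n) ?mxE//; exact/val_inj.
- rewrite [X in measurable_fun _ X](_ : _ =
      (fun x : 'rV[R]_n => x ord0 j) \o snd).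
    by apply: measurableT_comp; [exact: measurable_coord|].
  apply/funext => z; rewrite /cons_rV.
  by rewrite (_ : i = rshift 1 j) ?(@row_mxEr R 1 1 n)//; exact/val_inj.
Qed.

(* n-dimensional Lebesgue measure, as the iterated product measure *)
Fixpoint lebesgue_rV n : set 'rV[R]_n -> \bar R :=
  match n with
  | 0 => \d_(0%R : 'rV[R]_0)
  | m.+1 => pushforward (lebesgue_measure \x @lebesgue_rV m) (@cons_rV m)
  end.
Arguments lebesgue_rV : clear implicits.

Definition box n (r : R) : set 'rV[R]_n :=
  [set x | forall i, (`|x ord0 i| <= r)%R].

Lemma measurable_box n r : measurable (@box n r).
Proof.
have -> : @box n r = \bigcap_(i in [set: 'I_n])
    ((fun x : 'rV[R]_n => x ord0 i) @^-1` [set t | (`|t| <= r)%R]).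
  apply/seteqP; split=> x h; first by move=> i _; exact: h.
  by move=> i; exact: (h i I).
apply: fin_bigcap_measurable; first exact: finite_finset.
move=> i _; rewrite -[X in measurable X]setTI; apply: measurable_coord => //.
rewrite (_ : [set t | _] = `[(- r)%R, r]%classic)//.
by apply/seteqP; split => t /=; rewrite in_itv/= ler_norml.
Qed.

Lemma preimage_cons_box n r :
  @cons_rV n @^-1` (@box n.+1 r) = `[(- r)%R, r]%classic `*` @box n r.
Proof.
apply/seteqP; split => -[t x]; rewrite /box/=.
  move=> h; split=> [|i].
    by have := h (lshift n (ord0 : 'I_1)); rewrite (@row_mxEl R 1 1 n) mxE ler_norml.
  by have := h (rshift 1 i); rewrite (@row_mxEr R 1 1 n).
rewrite in_itv/= -ler_norml => -[ht hx] i.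
have [j|j] := splitP (i : 'I_(1 + n)) => ij.
- by rewrite (_ : i = lshift n j) ?(@row_mxEl R 1 1 n) ?mxE//; exact/val_inj.
- by rewrite (_ : i = rshift 1 j) ?(@row_mxEr R 1 1 n)//; exact/val_inj.
Qed.

Lemma bigcup_box n : \bigcup_k @box n k%:R = [set: 'rV[R]_n].
Proof.
apply/seteqP; split => // x _.
exists (Num.truncn (\sum_i `|x ord0 i|)%R).+1 => //= i.
rewrite (le_trans _ (ltW (truncnS_gt _)))//.
by rewrite (bigD1 i)//= lerDl sumr_ge0.
Qed.

Let lebesgue_rV_spec n : exists m : {sigma_finite_measure set 'rV[R]_n -> \bar R},
  lebesgue_rV n = m /\ forall r, m (@box n r) < +oo.
Proof.
have sigma_finite_box n' (m : {measure set 'rV[R]_n' -> \bar R}) :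
    (forall r, m (@box n' r) < +oo) -> sigma_finite setT m.
  move=> mfin; exists (fun k => @box n' k%:R); first by rewrite bigcup_box.
  by move=> k; split; [exact: measurable_box|exact: mfin].
have pack n' (m : {measure set 'rV[R]_n' -> \bar R}) :
    (forall r, m (@box n' r) < +oo) ->
    exists m' : {sigma_finite_measure set 'rV[R]_n' -> \bar R},
      (m : set _ -> \bar R) = m'.
  move=> /sigma_finite_box sm.
  pose H1 := isSFinite.Build _ _ _ _ (sfinite_measure_sigma_finite sm).
  pose H2 := isSigmaFinite.Build _ _ _ _ sm.
  by exists (HB.pack_for (SigmaFiniteMeasure.type 'rV[R]_n' R)
    (Measure.sort m) H1 H2).
suff : exists m : {measure set 'rV[R]_n -> \bar R},
    lebesgue_rV n = m /\ forall r, m (@box n r) < +oo.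
  move=> [m [mE mfin]]; have [m' mm'] := pack _ _ mfin.
  by exists m'; rewrite -mm' mE.
elim: n => [|n [m [mE mfin]]].
  exists \d_(0%R : 'rV[R]_0); split => // r.
  by rewrite /= diracE ltry.
have [m' mm'] := pack _ _ mfin.
pose P : {measure set (measurableTypeR R * 'rV[R]_n) -> \bar R} :=
  (lebesgue_measure \x m')%E.
have mc : measurable_fun [set: measurableTypeR R * 'rV[R]_n] (@cons_rV n).
  exact: measurable_cons_rV.
pose Q : {measure set 'rV[R]_n.+1 -> \bar R} :=
  measure_function_pushforward__canonical__measure_function_Measure P mc.
exists Q; split=> [|r]; first by rewrite /= mE mm'.
rewrite /= /pushforward preimage_cons_box product_measure1E//; last first.
  exact: measurable_box.
have := mfin r; rewrite mm' => mlty.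
rewrite lte_mul_pinfty//= lebesgue_measure_itv/=; by case: ifPn.
Qed.

Let lebesgue_rV0 n : lebesgue_rV n set0 = 0.
Proof. by have [m [-> _]] := lebesgue_rV_spec n; exact: measure0. Qed.

Let lebesgue_rV_ge0 n A : 0 <= lebesgue_rV n A.
Proof. by have [m [-> _]] := lebesgue_rV_spec n; exact: measure_ge0. Qed.

Let lebesgue_rV_sigma_additive n : semi_sigma_additive (lebesgue_rV n).
Proof.
by have [m [-> _]] := lebesgue_rV_spec n; exact: measure_semi_sigma_additive.
Qed.

HB.instance Definition _ n := isMeasure.Build _ _ _ (lebesgue_rV n)
  (@lebesgue_rV0 n) (@lebesgue_rV_ge0 n) (@lebesgue_rV_sigma_additive n).

Let lebesgue_rV_sigma_finite n : sigma_finite setT (lebesgue_rV n).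
Proof. by have [m [-> _]] := lebesgue_rV_spec n; exact: sigma_finiteT. Qed.

HB.instance Definition _ n := @Measure_isSigmaFinite.Build _ _ _
  (lebesgue_rV n) (@lebesgue_rV_sigma_finite n).

Lemma lebesgue_rV_box_lty n r : lebesgue_rV n (@box n r) < +oo.
Proof. by have [m [-> ->]] := lebesgue_rV_spec n. Qed.

End lebesgue_rV.
Arguments lebesgue_rV {R} n _.
Arguments box {R} n r _ /.

Section euclidean.
Context {R : realType}.
Implicit Types (n : nat).

(* The library's norm on 'rV[R]_n is the sup norm. *)
Definition enorm n (x : 'rV[R]_n) : R := Num.sqrt (\sum_i x ord0 i ^+ 2).

Definition unit_ball n : set 'rV[R]_n := [set x | enorm x < 1].

Definition unit_sphere n : set 'rV[R]_n := [set x | enorm x = 1].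

Definition direction n (x : 'rV[R]_n) : 'rV[R]_n := (enorm x)^-1 *: x.

Lemma measurable_enorm n : measurable_fun [set: 'rV[R]_n] (@enorm n).
Proof.
apply: (measurableT_comp
  (continuous_measurable_fun (@sqrt_continuous R))).
apply: measurable_sum => i; apply: measurable_funX; exact: measurable_coord.
Qed.

Lemma measurable_direction n : measurable_fun [set: 'rV[R]_n] (@direction n).
Proof.
apply: measurable_rVP => i.
rewrite [X in measurable_fun _ X](_ : _ =
  (fun x : 'rV[R]_n => enorm x `^ (-1) * x ord0 i)); last first.
  by apply/funext => x; rewrite mxE powR_inv1// sqrtr_ge0.
apply: measurable_funM; last exact: measurable_coord.
by apply: (measurableT_comp (measurable_powR _)); exact: measurable_enorm.
Qed.

Lemma measurable_enorm_preimage n (Y : set R) :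
  measurable Y -> measurable (@enorm n @^-1` Y).
Proof. by move=> mY; rewrite -[X in measurable X]setTI; exact: measurable_enorm. Qed.

Lemma measurable_unit_ball n : measurable (@unit_ball n).
Proof.
rewrite (_ : @unit_ball n = @enorm n @^-1` `]-oo, 1[%classic).
  exact: measurable_enorm_preimage.
by apply/seteqP; split => x /=; rewrite in_itv.
Qed.

Lemma measurable_unit_sphere n : measurable (@unit_sphere n).
Proof. exact: (measurable_enorm_preimage (measurable_set1 1)). Qed.

(* Surface measure on the unit sphere of R^n, extended by 0 to all of R^n:
   n times the volume of the cone { r w | 0 < r <= 1, w in A, |w| = 1 }. *)
Definition cone n (A : set 'rV[R]_n) : set 'rV[R]_n :=
  [set x | 0 < enorm x <= 1 /\ A (direction x)].

Definition surface_measure n (A : set 'rV[R]_n) : \bar R :=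
  (n%:R%:E * lebesgue_rV n (cone A))%E.

Let coneE n (A : set 'rV[R]_n) :
  cone A = @enorm n @^-1` `]0, 1]%classic `&` @direction n @^-1` A.
Proof. by apply/seteqP; split => x /=; rewrite in_itv. Qed.

Lemma measurable_cone n (A : set 'rV[R]_n) : measurable A -> measurable (cone A).
Proof.
move=> mA; rewrite coneE; apply: measurableI.
  exact: measurable_enorm_preimage.
by rewrite -[X in measurable X]setTI; exact: measurable_direction.
Qed.

Let surface_measure0 n : surface_measure (set0 : set 'rV[R]_n) = 0%E.
Proof.
rewrite /surface_measure (_ : cone (set0 : set 'rV[R]_n) = set0) ?measure0 ?mule0//.
by apply/seteqP; split => x // [].
Qed.

Let surface_measure_ge0 n (A : set 'rV[R]_n) : (0 <= surface_measure A)%E.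
Proof. by rewrite mule_ge0// lee_fin. Qed.

Let surface_measure_sigma_additive n :
  semi_sigma_additive (@surface_measure n).
Proof.
move=> F mF tF mUF.
have coneU : cone (\bigcup_k F k) = \bigcup_k cone (F k).
  apply/seteqP; split => [x [x1 [k _ Fk]]|x [k _ [x1 Fk]]]; first by exists k.
  by split => //; exists k.
have tC : trivIset setT (fun k => cone (F k)).
  move=> i j _ _ [x [[_ Fi] [_ Fj]]]; apply: tF => //.
  by exists (direction x).
rewrite /surface_measure coneU.
rewrite [X in X @ _ --> _](_ : _ =
  (fun k => n%:R%:E * \sum_(0 <= i < k) lebesgue_rV n (cone (F i)))%E).
  apply: cvgeZl => //; apply: measure_semi_sigma_additive => //.
    by move=> k; exact: measurable_cone.
  by apply: bigcupT_measurable => k; exact: measurable_cone.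
by apply/funext => k; rewrite ge0_sume_distrr.
Qed.

HB.instance Definition _ n := isMeasure.Build _ _ _ (@surface_measure n)
  (@surface_measure0 n) (@surface_measure_ge0 n)
  (@surface_measure_sigma_additive n).

Let surface_measure_fin_num n : fin_num_fun (@surface_measure n).
Proof.
move=> A mA; rewrite ge0_fin_numE// /surface_measure lte_mul_pinfty//.
apply: le_lt_trans (lebesgue_rV_box_lty n 1); apply: le_measure.
- by rewrite inE; exact: measurable_cone.
- by rewrite inE; exact: measurable_box.
move=> x [/andP[_ x1] _] i; rewrite (le_trans _ x1)// -sqrtr_sqr ler_wsqrtr//.
by rewrite (bigD1 i)//= lerDl sumr_ge0// => j _; exact: sqr_ge0.
Qed.

HB.instance Definition _ n := @Measure_isFinite.Build _ _ _
  (@surface_measure n) (@surface_measure_fin_num n).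

End euclidean.
Arguments surface_measure {R n} _.

Section exterior_problem.
Context {R : realType} {N : nat}.

(* Points of R x R^N are pairs (t, x). *)
Implicit Types (u phi psi : R * 'rV[R]_N -> R) (z : R * 'rV[R]_N).

Definition Omega : set (R * 'rV[R]_N) :=
  `]0, +oo[%classic `*` ~` @unit_ball R N.

Definition Gamma : set (R * 'rV[R]_N) :=
  `]0, +oo[%classic `*` @unit_sphere R N.

Definition dtdx : {measure set (measurableTypeR R * 'rV[R]_N) -> \bar R} :=
  (lebesgue_measure \x lebesgue_rV N)%E.

Definition dtdS : {measure set (measurableTypeR R * 'rV[R]_N) -> \bar R} :=
  (lebesgue_measure \x surface_measure)%E.

Definition partial_t phi z : R := derive1 (fun s : R => phi (s, z.2)) z.1.

Definition partial_x (i : 'I_N) phi z : R :=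
  'D_(delta_mx ord0 i) (fun y => phi (z.1, y)) z.2.

Definition laplacian phi z : R := \sum_i partial_x i (partial_x i phi) z.

Definition divergence (F : R * 'rV[R]_N -> 'rV[R]_N) z : R :=
  \sum_i partial_x i (fun w => F w ord0 i) z.

(* Unit normal on the unit sphere pointing out of the exterior domain. *)
Definition nu (x : 'rV[R]_N) : 'rV[R]_N := - x.

Definition normal_derivative phi z : R :=
  'D_(nu z.2) (fun y => phi (z.1, y)) z.2.

(* C^{1,2}_{t,x} on an open set U. *)
Definition C12_open (U : set (R * 'rV[R]_N)) phi : Prop :=
  forall z, U z ->
  [/\ {for z, continuous phi},
      derivable (fun s : R => phi (s, z.2)) z.1 1 /\
        {for z, continuous (partial_t phi)},
      forall i, derivable (fun y => phi (z.1, y)) z.2 (delta_mx ord0 i) /\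
        {for z, continuous (partial_x i phi)} &
      forall i j,
        derivable (fun y => partial_x i phi (z.1, y)) z.2 (delta_mx ord0 j) /\
        {for z, continuous (partial_x j (partial_x i phi))}].

(* Omega is not open (it contains Gamma): regularity up to Gamma is
   regularity on some open neighbourhood of Omega, so that derivatives at points
   of Gamma are ordinary ones. *)
Definition C12 phi : Prop :=
  exists U, [/\ open U, Omega `<=` U & C12_open U phi].

(* Only the values on Omega count for sign and support. *)
Definition nonneg_on_Omega phi : Prop := forall z, Omega z -> 0 <= phi z.

Definition supp phi : set (R * 'rV[R]_N) :=
  closure (Omega `&` [set z | phi z != 0]).

Definition compactly_supported phi : Prop :=
  compact (supp phi) /\ supp phi `<=` Omega.

Definition neumann_test (k : R) phi : Prop :=
  [/\ C12 phi, nonneg_on_Omega phi, compactly_supported phi &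
      forall z, Gamma z -> normal_derivative phi z + k * phi z = 0].

Definition dirichlet_test psi : Prop :=
  [/\ C12 psi, nonneg_on_Omega psi, compactly_supported psi,
      forall z, Gamma z -> psi z = 0 &
      forall z, Gamma z -> normal_derivative psi z <= 0].

Definition Lp_loc (p : R) u : Prop :=
  measurable_fun Omega u /\
  forall K, compact K -> K `<=` Omega ->
    (\int[dtdx]_(z in K) (`|u z| `^ p)%:E < +oo)%E.

(* - Delta phi + k div (phi x / |x|^2), derivatives in x only *)
Definition adjoint_operator (k : R) phi z : R :=
  - laplacian phi z +
    k * divergence (fun w => phi w *: ((enorm w.2 ^+ 2)^-1 *: w.2)) z.

Definition neumann_weak_solution (alpha sigma k p : R) (f : 'rV[R]_N -> R) u :
    Prop :=
  Lp_loc p u /\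
  forall phi, neumann_test k phi ->
    \int[dtdx]_(z in Omega)
       (z.1 `^ alpha * enorm z.2 `^ sigma * `|u z| `^ p * phi z) +
    \int[dtdS]_(z in Gamma) (f z.2 * phi z)
    <= - (\int[dtdx]_(z in Omega) (u z * partial_t phi z)) +
       \int[dtdx]_(z in Omega) (adjoint_operator k phi z * u z).

Definition dirichlet_weak_solution (alpha sigma k p : R) (f : 'rV[R]_N -> R) u :
    Prop :=
  Lp_loc p u /\
  forall psi, dirichlet_test psi ->
    \int[dtdx]_(z in Omega)
       (z.1 `^ alpha * enorm z.2 `^ sigma * `|u z| `^ p * psi z) -
    \int[dtdS]_(z in Gamma) (f z.2 * normal_derivative psi z)
    <= - (\int[dtdx]_(z in Omega) (u z * partial_t psi z)) +
       \int[dtdx]_(z in Omega) (adjoint_operator k psi z * u z).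

End exterior_problem.

(* Main.v *)
Require Import Defs.
From mathcomp Require Import all_boot all_order all_algebra.
From mathcomp Require Import all_classical all_reals all_analysis.
From mathcomp Require Import measurable_realfun ring lra.
Import Order.TTheory GRing.Theory Num.Theory.
Import numFieldNormedType.Exports.
Local Open Scope classical_set_scope.
Local Open Scope ring_scope.

(** The weak inequality is tested against separated functions
    phi (t, x) = tau (t) * h (s) * beta (s), where s = ln |x|^2.  In the variable
    s the adjoint operator applied to a radial function g (s) is
    |x|^-2 (- 4 g'' + (4 + 2 k - 2 N) g' + k (N - 2) g), whose kernel is spanned
    by exp (k s / 2) = |x|^k and exp (- (N - 2) s / 2) = |x|^(2 - N).  The factor
    h is |x|^k, which satisfies the Neumann-type condition on the sphere, or
    |x|^k - |x|^(2 - N), which vanishes there, has normal derivative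
    - (N + k - 2) and is positive outside the ball because k > 2 - N.  Since h is
    in the kernel, the adjoint operator only sees derivatives of the cutoff beta.

    The cutoff is logarithmic: beta is a bump in s / S with S = 2 m, so that
    each derivative costs a factor 1 / m, over the region 1 <= |x| <= e^m.  The
    time factor tau is a bump of length comparable with T = m e^(2m); this T is
    so large that the time derivative is at most of the same size.  Both
    derivatives are thus bounded by (C / m) |x|^-2 h zeta^(l + 1)
    ([derivatives_le]), where phi = h zeta^(l + 3) with 0 <= zeta <= 1.

    A Young-type inequality absorbs the product of |u| with this bound into
    the term |x|^sigma |u|^p phi, at the price of a remainder that does not
    contain u ([mul_le_absorb]).  With gamma = 1 / (p - 1), the critical value of
    p makes the powers of |x| in this remainder add up exactly to |x|^-N
    ([young_weight]), so the remainder is (C / m)^(1 + gamma) |x|^-N.  The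
    function |x|^-N has a logarithmically divergent integral: over the support
    of phi it integrates to at most a constant times m T, since each of the m
    shells e^j <= |x| <= e^(j + 1) contributes a bounded amount
    ([integral_shell_majorant]).  The nonlinear terms cancel and what is left is
    T I_f <= C' T m m^-(1 + gamma), that is I_f <= C' m^-gamma for every
    m >= 1, which is impossible for I_f > 0 ([no_test_family]). *)

(** * Directional derivatives and radial functions *)

Definition sqnorm {R : realType} {n} (x : 'rV[R]_n) : R := \sum_i x ord0 i ^+ 2.

Definition radial {R : realType} {n} (eta G : R -> R) (z : R * 'rV[R]_n) : R :=
  eta z.1 * G (sqnorm z.2).

Lemma ler_eq {R : realType} (x y : R) : x = y -> x <= y.
Proof. by move=> ->. Qed.

Section directional.
Context {R : realType} {n : nat}.
Implicit Types (x v : 'rV[R]_n) (f : 'rV[R]_n -> R).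

(** A derivative along [v] is an ordinary derivative on the line through [x],
    which makes the chain rule for real functions available. *)
Lemma is_derive_line f x v d :
  is_derive (0 : R) 1 (fun e => f (x + e *: v)) d <-> is_derive x v f d.
Proof.
pose q (V : normedModType R) (g : V -> R) (a w : V) : R -> R :=
  fun h => h^-1 *: ((g \o shift a) (h *: w) - g a).
have E : q R^o (fun e => f (x + e *: v)) 0 1 = q _ f x v.
  apply/funext => h; rewrite /q /=.
  rewrite addr0 scale0r addr0 (_ : h%:A = h) ; last exact: mulr1.
  by rewrite [h *: v + x]addrC.
have D1 : derivable (fun e : R => f (x + e *: v)) (0 : R) 1 = derivable f x v.
  by move: E; rewrite /derivable /q => ->.
have D2 : 'D_1 (fun e : R => f (x + e *: v)) (0 : R) = 'D_v f x.
  by move: E; rewrite /derive /q => ->.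
by split=> -[df dE]; split; rewrite ?D1 ?D2 // -?D1 -?D2.
Qed.

Lemma is_derive_comp f (g : R -> R) x v a b :
  is_derive (f x) 1 g a -> is_derive x v f b ->
  is_derive x v (fun y => g (f y)) (a * b).
Proof.
move=> dg /is_derive_line df; apply/is_derive_line.
by apply: is_derive1_comp; rewrite scale0r addr0.
Qed.

Lemma is_derive_coord x v i : is_derive x v (fun y => y ord0 i) (v ord0 i).
Proof.
apply/is_derive_line.
rewrite (_ : (fun _ => _) = (fun e => x ord0 i + e * v ord0 i)); last first.
  by apply/funext => e; rewrite !mxE.
by apply: is_derive_eq; rewrite /GRing.scale /=; ring.
Qed.

Lemma is_derive_sqnorm x v :
  is_derive x v (@sqnorm R n) (2 * \sum_i x ord0 i * v ord0 i).
Proof.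
rewrite /sqnorm.
rewrite (_ : (fun _ => _) = \sum_i (fun y : 'rV[R]_n => y ord0 i ^+ 2)); last first.
  by apply/funext => y; rewrite fct_sumE.
rewrite mulr_sumr; apply: is_derive_sum => i.
have := is_derive_coord x v i => H.
by apply: is_derive_eq; rewrite /GRing.scale /=; ring.
Qed.

End directional.

Section radial_calculus.
Context {R : realType} {n : nat}.
Implicit Types (z : R * 'rV[R]_n) (x v : 'rV[R]_n).

Lemma continuous_coord2 (i : 'I_n) : continuous (fun z : R * 'rV[R]_n => z.2 ord0 i).
Proof.
move=> z; apply: (@continuous_comp _ _ _ snd (fun y : 'rV[R]_n => y ord0 i)).
  exact: cvg_snd.
exact: coord_continuous.
Qed.

Lemma continuous_sqnorm : continuous (@sqnorm R n).
Proof.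
rewrite /sqnorm.
rewrite (_ : (fun _ => _) =
  \sum_i (fun y : 'rV[R]_n => y ord0 i ^+ 2)); last first.
  by apply/funext => y; rewrite fct_sumE.
move=> y; apply: (big_ind (fun g => {for y, continuous g})) => [|g h cg ch|i _].
- rewrite -[0]/(fun=> 0). exact: cst_continuous.
- exact: (@cvgD _ _ _ (nbhs y) _ g h).
- by apply: (@cvgM _ _ (nbhs y)); exact: coord_continuous.
Qed.

Lemma continuous_sqnorm2 : continuous (fun z : R * 'rV[R]_n => sqnorm z.2).
Proof.
move=> z; apply: (@continuous_comp _ _ _ snd (@sqnorm R n)).
  exact: cvg_snd.
exact: continuous_sqnorm.
Qed.

(** Radial functions of [ln (sqnorm x)] are smooth away from the origin; this
    open set is the neighbourhood of [Omega] on which test functions are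
    regular. *)
Definition punctured : set (R * 'rV[R]_n) := [set z | 0 < sqnorm z.2].

Lemma open_punctured : open punctured.
Proof.
rewrite (_ : punctured = (fun z => sqnorm z.2) @^-1` [set r : R | 0 < r])//.
by apply: open_comp; [move=> z _; exact: continuous_sqnorm2|exact: open_gt].
Qed.

Lemma near_punctured z : punctured z -> \forall w \near z, punctured w.
Proof. by move=> zp; exact: open_nbhs_nbhs (conj open_punctured zp). Qed.

Lemma near_punctured_x x : 0 < sqnorm x -> \forall y \near x, 0 < sqnorm y.
Proof. by move=> xp; have /(_ _ (lt_nbhsr xp)) := @continuous_sqnorm x. Qed.

Lemma sum_delta (x : 'rV[R]_n) i :
  \sum_j x ord0 j * (delta_mx ord0 i : 'rV[R]_n) ord0 j = x ord0 i.
Proof.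
rewrite (bigD1 i)//= mxE !eqxx mulr1 big1 ?addr0// => j ji.
by rewrite mxE (negbTE ji) andbF mulr0.
Qed.

Lemma is_derive_radial (eta G G' : R -> R) z v :
  (forall q : R, 0 < q -> is_derive q 1 G (G' q)) -> punctured z ->
  is_derive z.2 v (fun y => radial eta G (z.1, y))
    (eta z.1 * (G' (sqnorm z.2) * (2 * \sum_i z.2 ord0 i * v ord0 i))).
Proof.
move=> dG zp; rewrite /radial/=.
have H : is_derive z.2 v (fun y => G (sqnorm y))
   (G' (sqnorm z.2) * (2 * \sum_i z.2 ord0 i * v ord0 i)).
  by apply: is_derive_comp; [exact: dG|exact: is_derive_sqnorm].
by have := is_deriveZ (eta z.1) H.
Qed.

Lemma partial_x_radial (eta G G' : R -> R) z i :
  (forall q : R, 0 < q -> is_derive q 1 G (G' q)) -> punctured z ->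
  partial_x i (radial eta G) z = 2 * z.2 ord0 i * radial eta G' z.
Proof.
move=> dG zp; rewrite /partial_x.
have H := is_derive_radial eta _ _ z (delta_mx ord0 i) dG zp.
by rewrite (derive_val (is_derive := H)) sum_delta /radial; ring.
Qed.

(** First derivatives of a radial function, as well as the components of
    [phi x / |x|^2], are coordinates times radial functions; this formula
    therefore gives both the second derivatives and the divergence. *)
Lemma is_derive_coord_radial (eta G G' : R -> R) z i j :
  (forall q : R, 0 < q -> is_derive q 1 G (G' q)) -> punctured z ->
  is_derive z.2 (delta_mx ord0 j)
    (fun y => y ord0 i * radial eta G (z.1, y))
    ((i == j)%:R * radial eta G z + 2 * z.2 ord0 i * z.2 ord0 j * radial eta G' z).
Proof.
move=> dG zp.
have H1 := is_derive_radial eta _ _ z (delta_mx ord0 j) dG zp.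
have H2 := is_derive_coord z.2 (delta_mx ord0 j) i.
have := is_deriveM H2 H1.
move/is_derive_eq; apply.
by rewrite /GRing.scale /= sum_delta mxE eqxx /radial /=; ring.
Qed.

End radial_calculus.

Section radial_C12.
Context {R : realType} {n : nat}.
Implicit Types (z : R * 'rV[R]_n) (x v : 'rV[R]_n).

Lemma near_eq_continuous (f g : R * 'rV[R]_n -> R) z :
  {near z, f =1 g} -> {for z, continuous g} -> {for z, continuous f}.
Proof.
move=> fg cg; have fgz : f z = g z := nbhs_singleton fg.
rewrite /prop_for /continuous_at fgz; apply: cvg_trans cg.
by apply: near_eq_cvg; near=> w; apply/esym; near: w.
Unshelve. all: by end_near. Qed.

Lemma enorm_sqr x : enorm x ^+ 2 = sqnorm x.
Proof. by rewrite sqr_sqrtr// sumr_ge0// => i _; exact: sqr_ge0. Qed.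

Variables (eta eta1 G G1 G2 : R -> R).
Hypothesis deta : forall t : R, is_derive t 1 eta (eta1 t).
Hypothesis ceta1 : continuous eta1.
Hypothesis dG : forall q : R, 0 < q -> is_derive q 1 G (G1 q).
Hypothesis dG1 : forall q : R, 0 < q -> is_derive q 1 G1 (G2 q).
Hypothesis cG2 : forall q : R, 0 < q -> {for q, continuous G2}.

Lemma is_derive_radial_t z :
  is_derive z.1 1 (fun s => radial eta G (s, z.2)) (radial eta1 G z).
Proof.
rewrite /radial /=; have H := deta z.1.
have := is_deriveM H (is_derive_cst (G (sqnorm z.2)) z.1 1).
by move/is_derive_eq; apply; rewrite /GRing.scale /=; ring.
Qed.

Lemma partial_t_radial z : partial_t (radial eta G) z = radial eta1 G z.
Proof.
rewrite /partial_t derive1E; have H := is_derive_radial_t z.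
exact: (derive_val (is_derive := H)).
Qed.

Lemma is_derive_partial_x_radial z i j : punctured z ->
  is_derive z.2 (delta_mx ord0 j)
    (fun y => partial_x i (radial eta G) (z.1, y))
    (2 * ((i == j)%:R * radial eta G1 z
          + 2 * z.2 ord0 i * z.2 ord0 j * radial eta G2 z)).
Proof.
move=> zp.
have /= := is_deriveZ 2 (is_derive_coord_radial eta _ _ _ i j dG1 zp).
(* The formula for the first derivative holds only off the origin, hence only
   near z. *)
apply: near_eq_is_derive; near=> y.
rewrite (partial_x_radial _ _ G1)//=.
  by rewrite /radial /GRing.scale/=; ring.
by rewrite /punctured/=; near: y; exact: near_punctured_x.
Unshelve. all: by end_near. Qed.

Lemma partial_x2_radial z i j : punctured z ->
  partial_x j (partial_x i (radial eta G)) z =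
    2 * ((i == j)%:R * radial eta G1 z
          + 2 * z.2 ord0 i * z.2 ord0 j * radial eta G2 z).
Proof.
move=> zp; have H := is_derive_partial_x_radial z i j zp.
exact: (derive_val (is_derive := H)).
Qed.

Lemma adjoint_operator_radial k z : punctured z ->
  adjoint_operator k (radial eta G) z =
  eta z.1 * (let q := sqnorm z.2 in
    - (4 * q * G2 q + 2 * n%:R * G1 q) +
      k * (2 * q * (G1 q / q - G q / q ^+ 2) + n%:R * (G q / q))).
Proof.
move=> zp; rewrite /adjoint_operator /laplacian /divergence.
have dGq (q : R) : 0 < q ->
    is_derive q 1 (fun q => G q / q) (G1 q / q - G q / q ^+ 2).
  move=> q0; have H1 := dG q q0.
  have q00 : q != 0 by rewrite gt_eqF.
  have H2 : is_derive q 1 (fun q : R => q^-1) (- q ^- 2 * 1).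
    by have := is_deriveV q00 (is_derive_id q 1).
  have := is_deriveM H1 H2.
  by move/is_derive_eq; apply; rewrite /GRing.scale /=; field.
under eq_bigr do rewrite partial_x2_radial// eqxx.
have E i : partial_x i (fun w : R * 'rV_n =>
    (radial eta G w *: ((enorm w.2 ^+ 2)^-1 *: w.2)) ord0 i) z =
    radial eta (fun q => G q / q) z + 2 * z.2 ord0 i ^+ 2 *
       radial eta (fun q => G1 q / q - G q / q ^+ 2) z.
  have H := is_derive_coord_radial eta _ _ z i i dGq zp.
  rewrite /partial_x.
  rewrite (_ : (fun y => _) = (fun y : 'rV[R]_n =>
    y ord0 i * radial eta (fun q => G q / q) (z.1, y))).
    by rewrite (derive_val (is_derive := H)) eqxx mul1r expr2 mulrA.
  by apply/funext => y; rewrite !mxE enorm_sqr /radial /=; ring.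
under [in X in _ + k * X]eq_bigr do rewrite E.
rewrite -mulr_sumr !big_split/= -!mulr_suml -!mulr_sumr !sumr_const.
rewrite card_ord.
have -> : \sum_(i < n) 2 * z.2 ord0 i * z.2 ord0 i = 2 * sqnorm z.2.
  by rewrite /sqnorm mulr_sumr; apply: eq_bigr => i _; ring.
rewrite /radial /= -/(sqnorm z.2) -(mulr_natl (eta z.1)).
move: (sqnorm z.2) (eta z.1) (n%:R : R) => q e m.
move: (G q) (G1 q) (G2 q) q^-1 (q ^- 2) => a b c d f.
ring.
Qed.

Lemma continuous_radial (e g : R -> R) z :
  {for z.1, continuous e} -> {for sqnorm z.2, continuous g} ->
  {for z, continuous (radial e g)}.
Proof.
move=> ce cg; apply: (@cvgM _ _ (nbhs z)).
  by apply: (@continuous_comp _ _ _ fst e) => //; exact: cvg_fst.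
apply: (@continuous_comp _ _ _ (fun w => sqnorm w.2) g) => //.
exact: continuous_sqnorm2.
Qed.

Lemma C12_radial : C12_open (@punctured R n) (radial eta G).
Proof.
have cd (g g1 : R -> R) (y : R) : is_derive y 1 g (g1 y) -> {for y, continuous g}.
  by case=> dg _; apply: differentiable_continuous; exact/derivable1_diffP.
move=> z zp.
have ceta : {for z.1, continuous eta} by apply: cd; exact: deta.
have cG : {for sqnorm z.2, continuous G} by apply: cd; exact: dG.
have cG1 : {for sqnorm z.2, continuous G1} by apply: cd; exact: dG1.
split.
- exact: continuous_radial.
- split; first by have [] := is_derive_radial_t z.
  rewrite (_ : partial_t _ = radial eta1 G); last exact/funext/partial_t_radial.
  by apply: continuous_radial => //; exact: ceta1.
- move=> i; split; first by have [] := is_derive_radial eta _ _ z (delta_mx ord0 i) dG zp.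
  apply: (near_eq_continuous _ (fun w => 2 * w.2 ord0 i * radial eta G1 w)).
    near=> w; apply: partial_x_radial => //.
    by near: w; exact: near_punctured.
  apply: (@cvgM _ _ (nbhs z)); last exact: continuous_radial.
  by apply: (@cvgM _ _ (nbhs z)); [exact: cvg_cst|exact: continuous_coord2].
- move=> i j; split; first by have [] := is_derive_partial_x_radial z i j zp.
  apply: (near_eq_continuous _ (fun w => 2 * ((i == j)%:R * radial eta G1 w
          + 2 * w.2 ord0 i * w.2 ord0 j * radial eta G2 w))).
    near=> w; apply: partial_x2_radial.
    by near: w; exact: near_punctured.
  apply: (@cvgM _ _ (nbhs z)); first exact: cvg_cst.
  apply: (@cvgD _ _ _ (nbhs z)); apply: (@cvgM _ _ (nbhs z)).
  + exact: cvg_cst.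
  + exact: continuous_radial.
  + apply: (@cvgM _ _ (nbhs z)); last exact: continuous_coord2.
    by apply: (@cvgM _ _ (nbhs z)); [exact: cvg_cst|exact: continuous_coord2].
  + by apply: continuous_radial => //; exact: cG2.
Unshelve. all: by end_near. Qed.

End radial_C12.

(** * Truncated parabolas *)

Section bump.
Context {R : realType}.
Implicit Types (x y : R) (l : nat).

(** Powers of one truncated parabola serve as cutoffs: differentiating such a
    power lowers the exponent by one and keeps the same base, so derivatives of
    the cutoff are controlled by lower powers of the same function. *)
Definition hat l (y : R) : R := Num.max 0 (1 - y ^+ 2) ^+ l.

Lemma continuous_pospart (y : R) : {for y, continuous (fun r : R => Num.max 0 r)}.
Proof.
by apply: (@continuous_max R R^o (fun=> 0) id); [exact: cst_continuous|exact: cvg_id].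
Qed.

Lemma continuous_pospartX l y :
  {for y, continuous (fun r : R => Num.max 0 r ^+ l)}.
Proof.
apply: (@continuous_comp _ _ _ (fun r : R => Num.max 0 r) (fun r => r ^+ l)).
  exact: continuous_pospart.
exact: exprn_continuous.
Qed.

Lemma is_derive_pospartX l x :
  is_derive x 1 (fun r : R => Num.max 0 r ^+ l.+2)
    (l.+2%:R * Num.max 0 x ^+ l.+1).
Proof.
have [x0|x0|->] := ltgtP x 0.
- have H : is_derive x 1 (fun _ : R => 0 : R) 0 by exact: is_derive_cst.
  rewrite expr0n mulr0.
  apply: near_eq_is_derive H; near=> y.
  rewrite (_ : Num.max 0 y = 0) ?expr0n//; apply/max_idPl/ltW.
  by near: y; exact: lt_nbhsl.
- have H : is_derive x 1 (fun y : R => y ^+ l.+2) (l.+2%:R * x ^+ l.+1).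
    have := @is_deriveX _ _ id l.+2 x 1 1 (is_derive_id x 1).
    rewrite exprfctE.
    by move/is_derive_eq; apply; exact: mulr1.
  apply: near_eq_is_derive H; near=> y.
  rewrite (_ : Num.max 0 y = y)//; apply/max_idPr/ltW.
  by near: y; exact: lt_nbhsr.
(* At the corner the difference quotient is the next lower power of the
   positive part, which is continuous. *)
- rewrite ?expr0n ?mulr0.
  have max00 : Num.max 0 0 = 0 :> R by exact/max_idPl.
  pose f (r : R) : R := Num.max 0 r ^+ l.+2.
  have H : (fun h : R => h^-1 *: ((f \o shift 0) (h *: (1 : R)) - f 0)) @ 0^'
      --> (0 : R).
    have := @continuous_pospartX l.+1 0.
    rewrite /prop_for /continuous_at /= max00 expr0n /= => c0.
    have c1 : Num.max 0 h ^+ l.+1 @[h --> (0 : R)^'] --> (0 : R).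
      exact: cvg_within_filter c0.
    apply: cvg_trans c1.
    apply: near_eq_cvg; near=> h.
    have h0 : h != 0 by near: h; exact: nbhs_dnbhs_neq.
    rewrite /f /= addr0 max00 expr0n subr0 (_ : h *: 1 = h); last exact: mulr1.
    have [hp|hn] := ltP 0 h; last by rewrite !expr0n /GRing.scale/= mulr0.
    by rewrite [in RHS]exprS /GRing.scale /= mulKf.
  split; first by apply/cvg_ex; exists 0.
  exact: cvg_lim H.
Unshelve. all: by end_near. Qed.

Lemma continuous_hat l : continuous (hat l).
Proof.
move=> y; apply: (@continuous_comp _ _ _ (fun y : R => 1 - y ^+ 2)
   (fun r : R => Num.max 0 r ^+ l)); last exact: continuous_pospartX.
apply: (@cvgB _ _ _ (nbhs y)); first exact: cvg_cst.
exact: exprn_continuous.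
Qed.

Lemma is_derive_hat l y :
  is_derive y 1 (hat l.+2) (- (2 * l.+2%:R * (y * hat l.+1 y))).
Proof.
have H : is_derive y 1 (fun y : R => 1 - y ^+ 2) (- (2 * y)).
  have H2 := @is_deriveX _ _ id 2 y 1 1 (is_derive_id y 1).
  have := is_deriveB (is_derive_cst (1 : R) y 1) H2.
  by move/is_derive_eq; apply; rewrite /GRing.scale/=; ring.
have := @is_derive1_comp R _ (fun y : R => 1 - y ^+ 2) y _ _
  (is_derive_pospartX l (1 - y ^+ 2)) H.
by move/is_derive_eq; apply; rewrite /hat; ring.
Qed.

Lemma hat_ge0 l y : 0 <= hat l y.
Proof. by rewrite exprn_ge0// le_max lexx. Qed.

Lemma hat1_le1 y : hat 1 y <= 1.
Proof. by rewrite /hat expr1 ge_max ler01 gerBl sqr_ge0. Qed.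

Lemma hatE l y : hat l y = hat 1 y ^+ l.
Proof. by rewrite /hat expr1. Qed.

Lemma hat0 l : hat l 0 = 1.
Proof. by rewrite /hat expr0n subr0 (_ : Num.max 0 1 = 1) ?expr1n//; exact/max_idPr. Qed.

Lemma hat_eq0 l y : 1 <= `|y| -> hat l.+1 y = 0.
Proof.
move=> y1; rewrite /hat (_ : Num.max _ _ = 0) ?expr0n//; apply/max_idPl.
by rewrite subr_le0 -real_normK ?num_real// exprn_ege1.
Qed.

(** The parabola vanishes where [|y| >= 1], so polynomial factors in [y] cost
    nothing. *)
Lemma normM_hat_le l y : `|y| * hat l.+1 y <= hat l.+1 y.
Proof.
have [y1|/ltW y1] := leP 1 `|y|; first by rewrite hat_eq0// mulr0.
by rewrite ler_piMl ?hat_ge0.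
Qed.

Lemma hat_anti l m y : (l <= m)%N -> hat m y <= hat l y.
Proof.
by move=> lm; rewrite hatE [leRHS]hatE ler_wiXn2l ?hat_ge0 ?hat1_le1.
Qed.

End bump.

(** * The adjoint equation in the logarithmic variable *)

Section logarithmic_variable.
Context {R : realType}.
Variables (g g1 g2 : R -> R).
Hypothesis dg : forall s : R, is_derive s 1 g (g1 s).
Hypothesis dg1 : forall s : R, is_derive s 1 g1 (g2 s).

Lemma is_derive_comp_ln (q : R) : 0 < q ->
  is_derive q 1 (fun q => g (ln q)) (g1 (ln q) / q).
Proof.
by move=> q0; have := is_derive1_comp (dg (ln q)) (is_derive1_ln q0).
Qed.

Lemma is_derive2_comp_ln (q : R) : 0 < q ->
  is_derive q 1 (fun q => g1 (ln q) / q) ((g2 (ln q) - g1 (ln q)) / q ^+ 2).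
Proof.
move=> q0; have H1 := is_derive1_comp (dg1 (ln q)) (is_derive1_ln q0).
have q00 : q != 0 by rewrite gt_eqF.
have H2 : is_derive q 1 (fun q : R => q^-1) (- q ^- 2 * 1).
  by have := is_deriveV q00 (is_derive_id q 1).
have := is_deriveM H1 H2.
by move/is_derive_eq; apply; rewrite /GRing.scale /=; field.
Qed.

End logarithmic_variable.

Section profile.
Context {R : realType}.
Variables (a b : R) (e : bool) (S : R) (l : nat).
Implicit Types (s : R).
Hypothesis ab_gt0 : 0 < a + b.
Hypothesis S_ge1 : 1 <= S.

(** With [a = k / 2] and [b = (n - 2) / 2] the two exponentials of
    [s = ln |x|^2] are [|x|^k] and [|x|^(2 - n)], the radial solutions of the
    adjoint equation. *)
Definition modes (u v s : R) : R := u * expR (a * s) + v * expR (- b * s).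

Lemma is_derive_modes u v s :
  is_derive s 1 (modes u v) (modes (a * u) (- b * v) s).
Proof.
have H (c : R) : is_derive s 1 (fun s => expR (c * s)) (c * expR (c * s)).
  have := is_derive1_comp (is_derive_expR (c * s)) (is_deriveZ c (is_derive_id s 1)).
  by move/is_derive_eq; apply; rewrite /GRing.scale/=; ring.
have := is_deriveD (is_deriveZ u (H a)) (is_deriveZ v (H (- b))).
by move/is_derive_eq; apply; rewrite /GRing.scale/= /modes; ring.
Qed.

(** The flag [e] selects the boundary condition at [s = 0]: for [e = false] the
    mode is [|x|^k], adapted to the Neumann-type problem; for [e = true] the
    mode vanishes on the sphere, as the Dirichlet-type problem requires. *)
Definition mode : R -> R := modes 1 (- e%:R).
Definition mode1 : R -> R := modes (a * 1) (- b * - e%:R).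
Definition mode2 : R -> R := modes (a * (a * 1)) (- b * (- b * - e%:R)).

(** Convexity of the exponential: the Dirichlet mode grows at least linearly
    from the sphere. *)
Lemma mode_ge_expR s : 0 <= s -> e%:R * ((a + b) * s * expR (- b * s)) <= mode s.
Proof.
move=> s0; rewrite /mode /modes mul1r.
have -> : a * s = - b * s + (a + b) * s by ring.
rewrite expRD.
have H := expR_ge1Dx ((a + b) * s).
have := ler_wpM2l (expR_ge0 (- b * s)) H.
case: e => /=; last by move=> _; rewrite mul0r oppr0 mul0r addr0 mulr_ge0// expR_ge0.
by rewrite mul1r; nra.
Qed.

Lemma mode_ge0 s : 0 <= s -> 0 <= mode s.
Proof.
move=> s0; apply: le_trans (mode_ge_expR s s0).
by rewrite !mulr_ge0// ?expR_ge0// ltW.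
Qed.

Lemma mode_le_expR s : mode s <= expR (a * s).
Proof. by rewrite /mode /modes mul1r gerDl mulNr oppr_le0 mulr_ge0// expR_ge0. Qed.

(** Near the sphere the Dirichlet mode vanishes while its derivative does not.
    The extra factor [s] on the left repairs this; it will come from the
    derivative of the cutoff, which vanishes at [s = 0]. *)
Lemma mode1_le s : 0 <= s -> `|mode1 s| * s <= (`|a| * s + 1) * mode s.
Proof.
move=> s0; have H := mode_ge_expR s s0; have H0 := mode_ge0 s s0.
have -> : mode1 s = a * mode s + e%:R * ((a + b) * expR (- b * s)).
  by rewrite /mode1 /mode /modes; ring.
apply: (@le_trans _ _ ((`|a| * mode s + e%:R * ((a + b) * expR (- b * s))) * s)).
  apply: ler_wpM2r => //; apply: le_trans (ler_normD _ _) _.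
  rewrite normrM (ger0_norm H0) lerD2l ger0_norm//.
  by rewrite !mulr_ge0// ?expR_ge0// ltW.
rewrite [leRHS]mulrDl mul1r mulrDl; apply: lerD; first by rewrite mulrAC.
by apply: le_trans H; rewrite -!mulrA [expR _ * s]mulrC.
Qed.

Definition cutoff m s : R := hat m (s / S).

Lemma is_derive_divS s : is_derive s 1 (fun x : R => x / S) S^-1.
Proof.
have := is_deriveM (is_derive_id s 1) (is_derive_cst S^-1 s 1).
by move/is_derive_eq; apply; rewrite /GRing.scale/=; ring.
Qed.

Lemma is_derive_cutoff m s : is_derive s 1 (cutoff m.+2)
  (- (2 * m.+2%:R / S * (s / S * cutoff m.+1 s))).
Proof.
have := @is_derive1_comp R _ (fun x : R => x / S) s _ _
  (is_derive_hat m (s / S)) (is_derive_divS s).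
by move/is_derive_eq; apply; rewrite /cutoff; ring.
Qed.

Let c := 2 * l.+3%:R / S.

Definition profile s : R := mode s * cutoff l.+3 s.
Definition profile1 s : R :=
  mode1 s * cutoff l.+3 s - mode s * (c * (s / S * cutoff l.+2 s)).
Definition profile2 s : R :=
  mode2 s * cutoff l.+3 s - 2 * mode1 s * (c * (s / S * cutoff l.+2 s))
  - mode s * (c * (cutoff l.+2 s / S
                   - s / S * (2 * l.+2%:R / S * (s / S * cutoff l.+1 s)))).

Lemma is_derive_profile s : is_derive s 1 profile (profile1 s).
Proof.
have := is_deriveM (is_derive_modes 1 (- e%:R) s) (is_derive_cutoff l.+1 s).
by move/is_derive_eq; apply; rewrite /GRing.scale/= /profile1 /c /mode1 /mode; ring.
Qed.

Lemma is_derive_profile1 s : is_derive s 1 profile1 (profile2 s).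
Proof.
have H1 := is_deriveM (is_derive_modes (a * 1) (- b * - e%:R) s) (is_derive_cutoff l.+1 s).
have H2 : is_derive s 1 (fun x => x / S * cutoff l.+2 x) _ :=
  is_deriveM (is_derive_divS s) (is_derive_cutoff l s).
have H3 := is_deriveM (is_derive_modes 1 (- e%:R) s) (is_deriveZ c H2).
have := is_deriveB H1 H3.
rewrite (_ : _ - _ = profile1).
  move/is_derive_eq; apply; rewrite /= /GRing.scale/= /profile2 /c /mode2 /mode1 /mode.
  ring.
by apply/funext => x; rewrite /profile1 /GRing.scale/= !fctE.
Qed.

Lemma continuous_profile2 : continuous profile2.
Proof.
have cm u v : continuous (modes u v).
  move=> x; apply: differentiable_continuous; apply/derivable1_diffP.
  by have [] := is_derive_modes u v x.
have cy : continuous (fun s : R => s / S).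
  by move=> x; apply: cvgM; [exact: cvg_id|exact: cvg_cst].
have cc m : continuous (cutoff m).
  by move=> x; apply: (continuous_comp (cy x)); exact: continuous_hat.
move=> s; apply: (@cvgB _ _ _ (nbhs s)).
  apply: (@cvgB _ _ _ (nbhs s)); first by apply: (@cvgM _ _ (nbhs s)); [exact: cm|exact: cc].
  apply: (@cvgM _ _ (nbhs s)).
    by apply: (@cvgM _ _ (nbhs s)); [exact: cvg_cst|exact: cm].
  apply: (@cvgM _ _ (nbhs s)); first exact: cvg_cst.
  by apply: (@cvgM _ _ (nbhs s)); [exact: cy|exact: cc].
apply: (@cvgM _ _ (nbhs s)); first exact: cm.
apply: (@cvgM _ _ (nbhs s)); first exact: cvg_cst.
apply: (@cvgB _ _ _ (nbhs s)).
  by apply: (@cvgM _ _ (nbhs s)); [exact: cc|exact: cvg_cst].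
apply: (@cvgM _ _ (nbhs s)); first exact: cy.
apply: (@cvgM _ _ (nbhs s)); first exact: cvg_cst.
by apply: (@cvgM _ _ (nbhs s)); [exact: cy|exact: cc].
Qed.

Variables (n : nat) (k : R).
Hypothesis aE : a = k / 2.
Hypothesis bE : b = (n%:R - 2) / 2.

(** The adjoint operator applied to the profile, multiplied by [|x|^2]: in the
    variable [s = ln |x|^2] its coefficients are constant. *)
Definition log_adjoint s : R :=
  - 4 * profile2 s + (4 + 2 * k - 2 * n%:R) * profile1 s
  + k * (n%:R - 2) * profile s.

Definition log_adjoint_bound : R :=
  2 * l.+3%:R * (8 * (`|a| + 1) + 4 * (1 + 2 * l.+2%:R) + `|4 + 2 * k - 2 * n%:R|).

(** Terms without a derivative of the cutoff cancel because the mode solves the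
    adjoint equation; every remaining term carries a factor [1 / S]. *)
Lemma log_adjoint_le s : 0 <= s ->
  `|log_adjoint s| <= log_adjoint_bound / S * (mode s * cutoff l.+1 s).
Proof.
move=> s0; have H0 := mode_ge0 s s0; have H1 := mode1_le s s0.
have Sgt0 : 0 < S by exact: lt_le_trans S_ge1.
have y0 : 0 <= s / S by rewrite divr_ge0// ltW.
have c0 : 0 <= c by rewrite /c divr_ge0 ?mulr_ge0// ltW.
have cut0 m : 0 <= cutoff m s := hat_ge0 _ _.
have c21 : cutoff l.+2 s <= cutoff l.+1 s := hat_anti l.+1 l.+2 _ (leqnSn _).
have yc1 : s / S * cutoff l.+1 s <= cutoff l.+1 s.
  by have := normM_hat_le l (s / S); rewrite ger0_norm.
have yc2 : s / S * cutoff l.+2 s <= cutoff l.+1 s.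
  by apply: (le_trans _ yc1); rewrite ler_wpM2l.
have -> : log_adjoint s = c * (8 * (mode1 s * (s / S * cutoff l.+2 s))
  + 4 * (mode s * (cutoff l.+2 s / S))
  - 8 * l.+2%:R * (mode s * (s / S * (s / S * cutoff l.+1 s)) / S)
  - (4 + 2 * k - 2 * n%:R) * (mode s * (s / S * cutoff l.+2 s))).
  rewrite /log_adjoint /profile /profile1 /profile2 /mode /mode1 /mode2 /modes aE bE.
  by field; rewrite gt_eqF.
rewrite normrM (ger0_norm c0) /log_adjoint_bound /c.
set M := mode s * cutoff l.+1 s; set K := 4 + 2 * k - 2 * n%:R.
have M0 : 0 <= M by rewrite mulr_ge0.
have T2 : mode s * (cutoff l.+2 s / S) <= M.
  apply: ler_wpM2l => //; apply: (le_trans _ c21).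
  by rewrite ler_pdivrMr// ler_peMr.
have T4 : mode s * (s / S * cutoff l.+2 s) <= M by exact: ler_wpM2l.
have T3 : mode s * (s / S * (s / S * cutoff l.+1 s)) / S <= M.
  rewrite ler_pdivrMr//; apply: (@le_trans _ _ M); last by rewrite ler_peMr.
  apply: ler_wpM2l => //; apply: (le_trans _ yc1).
  exact: (ler_wpM2l y0 yc1).
have T1 : `|mode1 s * (s / S * cutoff l.+2 s)| <= (`|a| + 1) * M.
  rewrite normrM [X in _ * X]ger0_norm; last exact: mulr_ge0.
  have -> : `|mode1 s| * (s / S * cutoff l.+2 s) =
      `|mode1 s| * s * (cutoff l.+2 s / S) by ring.
  apply: le_trans (ler_wpM2r _ H1) _; first by rewrite divr_ge0// ltW.
  have -> : (`|a| * s + 1) * mode s * (cutoff l.+2 s / S) =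
    `|a| * (mode s * (s / S * cutoff l.+2 s)) + mode s * (cutoff l.+2 s / S) by ring.
  by rewrite [leRHS]mulrDl mul1r lerD// ler_wpM2l.
have P2 : 0 <= mode s * (cutoff l.+2 s / S) by rewrite mulr_ge0// divr_ge0// ltW.
have P4 : 0 <= mode s * (s / S * cutoff l.+2 s) by do 2 apply: mulr_ge0 => //.
have P3 : 0 <= mode s * (s / S * (s / S * cutoff l.+1 s)) / S.
  by apply: divr_ge0; [do 3 apply: mulr_ge0 => //|exact: ltW].
have -> : 2 * l.+3%:R * (8 * (`|a| + 1) + 4 * (1 + 2 * l.+2%:R) + `|K|) / S * M =
  2 * l.+3%:R / S * ((8 * (`|a| + 1) + 4 * (1 + 2 * l.+2%:R) + `|K|) * M) by ring.
apply: ler_wpM2l => //.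
have T5 : `|K * (mode s * (s / S * cutoff l.+2 s))| <= `|K| * M.
  by rewrite normrM (ger0_norm P4) ler_wpM2l.
have l0 : 0 <= l.+2%:R :> R by [].
have T6 := ler_wpM2l l0 T3.
have P6 := mulr_ge0 l0 P3.
move: T1 T2 T5 T6 P2 P6; rewrite !ler_norml.
move=> /andP[? ?] ? /andP[? ?] ? ? ?.
by apply/andP; split; nra.
Qed.

End profile.

(** * Absorption into the nonlinear term *)

Section young.
Context {R : realType}.

(** Either [D] is at most [w X^(p-1) z^2], and the first term on the right is
    large enough; or [X z^(2 gamma) < (D / w)^gamma], and the second one is.  The
    exponent [l] is large enough for [z^(l+1) <= z^(2 gamma)]. *)
Lemma mul_le_absorb (X D w z p gamma : R) (l : nat) :
  0 <= X -> 0 < D -> 0 < w -> 0 <= z <= 1 -> 1 < p -> gamma = (p - 1)^-1 ->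
  2 * gamma <= l.+1%:R ->
  X * D * z ^+ l.+1 <= w * X `^ p * z ^+ l.+3 + D * (D / w) `^ gamma.
Proof.
move=> X0 D0 w0 /andP[z0 z1] p1 gE gl.
have p10 : 0 < p - 1 by rewrite subr_gt0.
have g0 : 0 < gamma by rewrite gE invr_gt0.
have [DX|DX] := leP D (w * X `^ (p - 1) * z ^+ 2).
  apply: ler_wpDr; first by rewrite mulr_ge0 ?powR_ge0// ltW.
  rewrite -(mulr_powRB1 X0); last exact: lt_trans p1.
  rewrite -(addn2 l.+1) exprD.
  have := ler_wpM2l (mulr_ge0 X0 (exprn_ge0 l.+1 z0)) DX.
  by move=> H; nra.
apply: ler_wpDl.
  by rewrite mulr_ge0 ?exprn_ge0// mulr_ge0 ?powR_ge0// ltW.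
rewrite mulrAC [leRHS]mulrC ler_pM2r//.
have H : X `^ (p - 1) * z ^+ 2 <= D / w.
  by rewrite ler_pdivlMr// mulrC mulrA ltW.
have := ge0_ler_powR (ltW g0) _ _ H; rewrite !nnegrE.
rewrite powRM ?powR_ge0 ?exprn_ge0// -powRrM gE divff ?gt_eqF// powRr1// -gE.
move=> H1; apply: le_trans (H1 _ _).
- apply: ler_wpM2l => //.
  have [->|zn0] := eqVneq z 0; first by rewrite expr0n powR_ge0.
  rewrite -(powR_mulrn 2)// -powRrM -powR_mulrn//.
  by apply: ger_powR => //; rewrite z1 lt_neqAle eq_sym zn0 z0.
- by rewrite mulr_ge0 ?powR_ge0 ?exprn_ge0.
- by rewrite divr_ge0// ltW.
Qed.

(** The only place where the critical exponent matters: with [|x| = exp (s / 2)],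
    the powers of [|x|] coming from the mode, from the adjoint operator and from
    the weight [|x|^sigma] combine to [|x|^-n]. *)
Lemma young_weight (s k sigma n gamma c h : R) :
  -2 < sigma -> gamma = (n + k - 2) / (sigma + 2) -> 0 < c ->
  h <= expR (k / 2 * s) ->
  h * (c * expR (- s) * (c * expR (- s) / expR (s / 2 * sigma)) `^ gamma)
  <= c `^ (1 + gamma) * expR (- (n / 2) * s).
Proof.
move=> sg gE c0 hk.
have -> : c * expR (- s) / expR (s / 2 * sigma) = c * expR (- s - s / 2 * sigma).
  by rewrite -expRN -mulrA -expRD.
rewrite powRM ?expR_ge0 ?(ltW c0)// -expRM.
have cE : c `^ (1 + gamma) = c * c `^ gamma.
  by rewrite powRD ?powRr1 ?(ltW c0)//; apply/implyP => _; rewrite gt_eqF.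
rewrite cE.
have -> : - (n / 2) * s = k / 2 * s + (- s + (- s - s / 2 * sigma) * gamma).
  rewrite gE; field; rewrite gt_eqF//; lra.
rewrite !expRD.
set A := expR (- s); set B := expR (_ * gamma).
rewrite [leRHS](_ : _ = expR (k / 2 * s) * (c * A * (c `^ gamma * B))); last by ring.
by apply: ler_wpM2r => //; rewrite !mulr_ge0// ?powR_ge0 ?expR_ge0// ltW.
Qed.

End young.

(** * Logarithmic growth of the integral of the inverse n-th power *)

Section shells.
Context {R : realType}.

Lemma lebesgue_rV_box n (r : R) : 0 <= r ->
  lebesgue_rV n (box n r) = ((2 * r) ^+ n)%:E.
Proof.
move=> r0; elim: n => [|n IH].
  rewrite /= diracE expr0 mem_set//; by case.
rewrite /= /pushforward preimage_cons_box product_measure1E//; last first.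
  exact: measurable_box.
rewrite -[X in (_ * X)%E]/(lebesgue_rV n (box n r)) IH.
rewrite /= lebesgue_measure_itv/= lte_fin.
case: ltP => [_|rr]; first by rewrite -EFinB -EFinM exprS; congr (_ * _)%:E; ring.
by rewrite (_ : r = 0) ?mulr0 ?expr0n ?mul0e//; lra.
Qed.

Lemma sqnorm_gt0_enorm n (x : 'rV[R]_n) : 0 < sqnorm x -> enorm x = expR (ln (sqnorm x) / 2).
Proof.
move=> q0; rewrite /enorm -/(sqnorm x) -[in LHS](@lnK _ (sqnorm x)) ?posrE//.
have -> : ln (sqnorm x) = ln (sqnorm x) / 2 + ln (sqnorm x) / 2 by field.
by rewrite expRD -expr2 sqrtr_sqr ger0_norm ?expR_ge0//; congr expR; field.
Qed.

Lemma coord_le_enorm n (x : 'rV[R]_n) i : `|x ord0 i| <= enorm x.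
Proof.
rewrite -sqrtr_sqr ler_wsqrtr// (bigD1 i)//= lerDl sumr_ge0// => j _.
exact: sqr_ge0.
Qed.

Definition shell_block n (T : R) (j : nat) : set (R * 'rV[R]_n) :=
  `[T, 3 * T]%classic `*` box n (expR j.+1%:R).

(** A step function above [|x|^-n]: on the shell [e^j <= |x| <= e^(j+1)], which
    lies in the box of half-width [e^(j+1)], the constant [e^(- n j)] dominates.
    Boxes rather than shells spare polar coordinates and only lose a constant. *)
Definition shell_majorant n (T : R) (m : nat) (z : R * 'rV[R]_n) : R :=
  \sum_(j < m) expR (- (n%:R * j%:R)) * \1_(shell_block n T j) z.

Lemma shell_majorant_ge0 n T m (z : R * 'rV[R]_n) : 0 <= shell_majorant n T m z.
Proof. by apply: sumr_ge0 => j _; rewrite mulr_ge0 ?expR_ge0. Qed.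

Lemma le_shell_majorant n T m (z : R * 'rV[R]_n) s :
  enorm z.2 = expR (s / 2) -> T <= z.1 <= 3 * T -> (0 < m)%N ->
  0 <= s <= 2 * m%:R ->
  expR (- (n%:R / 2) * s) <= shell_majorant n T m z.
Proof.
move=> zE zT m0 /andP[s0 sm].
have [j jm /andP[js sj]] : exists2 j : nat, (j < m)%N & j%:R <= s / 2 <= j.+1%:R.
  have t0 : 0 <= s / 2 by lra.
  have tm : s / 2 <= m%:R by lra.
  elim: m m0 tm {sm} => // m IH _ tm.
  have [tm'|tm'] := leP m%:R (s / 2); first by exists m; rewrite // tm'.
  case: m IH tm tm' => [|m] IH tm tm'; first lra.
  by have [j jm ?] := IH isT (ltW tm'); exists j => //; exact: ltnW.
rewrite /shell_majorant (bigD1 (Ordinal jm))//= indicE mem_set; last first.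
  split=> /=; first by rewrite in_itv.
  by move=> i; rewrite (le_trans (coord_le_enorm _ _ _))// zE ler_expR.
rewrite mulr1; apply: ler_wpDr.
  by apply: sumr_ge0 => i _; rewrite mulr_ge0 ?expR_ge0.
rewrite ler_expR; have := ler_wpM2l (ler0n R n) js; lra.
Qed.

Lemma measurable_shell_block n T j : measurable (shell_block n T j).
Proof. by apply: measurableX => //; exact: measurable_box. Qed.

Lemma dtdx_shell_block n (T : R) j : 0 < T ->
  @dtdx R n (shell_block n T j) = (2 * T * (2 * expR j.+1%:R) ^+ n)%:E.
Proof.
move=> T0; have mI : measurable (`[T, 3 * T]%classic : set (measurableTypeR R)) by [].
apply: (eq_trans (product_measure1E (@lebesgue_measure R) (@lebesgue_rV R n) mI
  (@measurable_box R n (expR j.+1%:R)))).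
rewrite -[X in (_ * X)%E]/(lebesgue_rV n (box n (expR j.+1%:R))).
rewrite lebesgue_rV_box ?expR_ge0//= lebesgue_measure_itv/= lte_fin.
rewrite ifT; last by lra.
by rewrite -EFinB -EFinM; congr (_ * _)%:E; ring.
Qed.

Lemma measurable_shell_majorant n T m :
  measurable_fun [set: measurableTypeR R * 'rV[R]_n] (shell_majorant n T m).
Proof.
apply: measurable_sum => j; apply: measurable_funM => //.
by apply: measurable_indic; exact: measurable_shell_block.
Qed.

(** By scaling the integral of each of the [m] terms is the same, whence the
    linear growth in [m]. *)
Lemma integral_shell_majorant n (T : R) m : 0 < T ->
  (\int[@dtdx R n]_z (shell_majorant n T m z)%:E =
   (m%:R * (2 * T * (2 * expR 1) ^+ n))%:E)%E.
Proof.
move=> T0; rewrite /shell_majorant.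
under eq_integral do rewrite -sumEFin.
have mE (j : 'I_m) : measurable_fun [set: measurableTypeR R * 'rV[R]_n]
    (fun z => ((expR (- (n%:R * j%:R)) : R) * \1_(shell_block n T j) z)%:E).
  apply/measurable_EFinP; apply: measurable_funM => //.
  by apply: measurable_indic; exact: measurable_shell_block.
have pE (j : 'I_m) (z : R * 'rV[R]_n) :
    (0 <= ((expR (- (n%:R * j%:R)) : R) * \1_(shell_block n T j) z)%:E)%E.
  by rewrite lee_fin mulr_ge0 ?expR_ge0.
rewrite (ge0_integral_sum _ _ mE)//=.
rewrite (eq_bigr (fun=> (2 * T * (2 * expR 1) ^+ n)%:E)); last first.
  move=> j _; under eq_integral do rewrite EFinM.
  have mI : measurable_fun [set: measurableTypeR R * 'rV[R]_n]
      (fun z => (\1_(shell_block n T j) z : R)%:E).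
    apply/measurable_EFinP.
    by apply: measurable_indic; exact: measurable_shell_block.
  rewrite (ge0_integralZl_EFin _ _ _ mI) ?expR_ge0//.
  rewrite integral_indic//; last exact: measurable_shell_block.
  rewrite setIT dtdx_shell_block// -EFinM; congr EFin.
  rewrite -[j.+1%:R]natr1 expRD [2 * (expR j%:R * _)]mulrCA.
  rewrite [(_ * (2 * _)) ^+ n]exprMn expRN expRM_natl.
  by rewrite mulrCA mulKf// expf_neq0// gt_eqF// expR_gt0.
by rewrite sumEFin sumr_const card_ord -[in LHS](mulr_natl (2 * T * _)).
Qed.

End shells.

(** * The test functions *)

Section test_function.
Context {R : realType} {n : nat}.
Variables (k : R) (e : bool) (l m : nat).
Implicit Types (z : R * 'rV[R]_n) (t : R).
Hypothesis m_gt0 : (0 < m)%N.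
Hypothesis nk_gt : 2 - n%:R < k.

Let a := k / 2.
Let b : R := (n%:R - 2) / 2.
(** The factor [exp (2 m)] is the largest value of [|x|^2] on the support of the
    test function, so [1 / horizon <= |x|^-2 / m] there. *)
Definition horizon : R := m%:R * expR (2 * m%:R).
Let T := horizon.
Let S : R := 2 * m%:R.

Definition time_cutoff j t : R := hat j ((t - 2 * T) / T).
Definition time_cutoff1 t : R :=
  - (2 * l.+3%:R * ((t - 2 * T) / T * hat l.+2 ((t - 2 * T) / T))) / T.

Let m1 : 1 <= m%:R :> R. Proof. by rewrite ler1n. Qed.
Let S_ge1 : 1 <= S. Proof. by have := m1; rewrite /S; lra. Qed.
Let ab_gt0 : 0 < a + b. Proof. by have := nk_gt; rewrite /a /b; lra. Qed.

Lemma horizon_gt0 : 0 < T.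
Proof. by rewrite mulr_gt0 ?expR_gt0// (lt_le_trans _ m1). Qed.

Lemma is_derive_time_cutoff t : is_derive t 1 (time_cutoff l.+3) (time_cutoff1 t).
Proof.
have H : is_derive t 1 (fun x : R => (x - 2 * T) / T) T^-1.
  have H1 := is_deriveB (is_derive_id t 1) (is_derive_cst (2 * T) t 1).
  have := is_deriveM H1 (is_derive_cst T^-1 t 1).
  by move/is_derive_eq; apply; rewrite /GRing.scale/=; ring.
have := @is_derive1_comp R _ (fun x : R => (x - 2 * T) / T) t _ _
  (is_derive_hat l.+1 ((t - 2 * T) / T)) H.
by move/is_derive_eq; apply; rewrite /time_cutoff1; ring.
Qed.

Let continuous_phase : continuous (fun t : R => (t - 2 * T) / T).
Proof.
move=> t; apply: (@cvgM _ _ (nbhs t)); last exact: cvg_cst.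
by apply: (@cvgB _ _ _ (nbhs t)); [exact: cvg_id|exact: cvg_cst].
Qed.

Lemma continuous_time_cutoff j : continuous (time_cutoff j).
Proof.
by move=> t; apply: (continuous_comp (continuous_phase t)); exact: continuous_hat.
Qed.

Lemma continuous_time_cutoff1 : continuous time_cutoff1.
Proof.
move=> t; apply: (@cvgM _ _ (nbhs t)); last exact: cvg_cst.
apply: (@cvgN _ _ _ (nbhs t)); apply: (@cvgM _ _ (nbhs t)); first exact: cvg_cst.
apply: (@cvgM _ _ (nbhs t)); first exact: continuous_phase.
by apply: (continuous_comp (continuous_phase t)); exact: continuous_hat.
Qed.

Lemma time_cutoff_eq0 j t : ~~ (T <= t <= 3 * T) -> time_cutoff j.+1 t = 0.
Proof.
have T0 := horizon_gt0.
move=> tT; rewrite /time_cutoff hat_eq0// ler_normr.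
move: tT; rewrite negb_and -!ltNge => /orP[tT|tT]; apply/orP; [right|left].
  by rewrite -[leRHS]mulNr ler_pdivlMr// mul1r; lra.
by rewrite ler_pdivlMr// mul1r; lra.
Qed.

Definition space_profile : R -> R := profile a b e S l.
Definition test_function : R * 'rV[R]_n -> R :=
  radial (time_cutoff l.+3) (fun q => space_profile (ln q)).

Let dprofile := is_derive_profile a b e S l.
Let dprofile1 := is_derive_profile1 a b e S l.

Let dspace_profile (q : R) : 0 < q ->
  is_derive q 1 (fun q => space_profile (ln q)) (profile1 a b e S l (ln q) / q).
Proof. by move=> q0; exact: is_derive_comp_ln. Qed.

Let dspace_profile1 (q : R) : 0 < q ->
  is_derive q 1 (fun q => profile1 a b e S l (ln q) / q)
    ((profile2 a b e S l (ln q) - profile1 a b e S l (ln q)) / q ^+ 2).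
Proof. by move=> q0; exact: is_derive2_comp_ln. Qed.

Lemma C12_test_function : C12_open (@punctured R n) test_function.
Proof.
apply: (@C12_radial _ _ _ time_cutoff1 _ (fun q => profile1 a b e S l (ln q) / q)
  (fun q => (profile2 a b e S l (ln q) - profile1 a b e S l (ln q)) / q ^+ 2)).
- exact: is_derive_time_cutoff.
- exact: continuous_time_cutoff1.
- exact: dspace_profile.
- exact: dspace_profile1.
move=> q q0; apply: (@cvgM _ _ (nbhs q)).
  apply: (@cvgB _ _ _ (nbhs q)).
    apply: continuous_comp; first exact: continuous_ln.
    exact: continuous_profile2.
  apply: continuous_comp; first exact: continuous_ln.
  apply: differentiable_continuous; apply/derivable1_diffP.
  by have [] := dprofile1 (ln q).
apply: (@cvgV _ _ (nbhs q)); first by rewrite expf_neq0// gt_eqF.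
exact: exprn_continuous.
Qed.

Lemma partial_t_test_function z : partial_t test_function z =
  time_cutoff1 z.1 * space_profile (ln (sqnorm z.2)).
Proof. exact: (partial_t_radial _ time_cutoff1 _ is_derive_time_cutoff). Qed.

Lemma adjoint_operator_test_function z : punctured z ->
  adjoint_operator k test_function z = time_cutoff l.+3 z.1 *
    (log_adjoint a b e S l n k (ln (sqnorm z.2)) * expR (- ln (sqnorm z.2))).
Proof.
move=> zp; rewrite /test_function.
rewrite (adjoint_operator_radial _ _ _ _ dspace_profile dspace_profile1)//.
rewrite expRN lnK ?posrE//= /log_adjoint /space_profile; congr (_ * _).
by field; rewrite gt_eqF.
Qed.

(** The cutoff is stationary at [s = 0], so only the mode contributes. *)
Lemma normal_derivative_test_function z : sqnorm z.2 = 1 ->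
  normal_derivative test_function z = - (k + e%:R * (n%:R - 2)) * time_cutoff l.+3 z.1.
Proof.
move=> z1; rewrite /normal_derivative /nu.
have zp : punctured z by rewrite /punctured/= z1.
have H := is_derive_radial (time_cutoff l.+3) _ _ z (- z.2) dspace_profile zp.
rewrite (derive_val (is_derive := H)) z1 ln1 divr1.
rewrite (_ : \sum_i _ = -1); last first.
  rewrite -z1 /sqnorm -sumrN; apply: eq_bigr => i _.
  by rewrite !mxE; ring.
rewrite /profile1 /mode1 /modes /cutoff !mul0r !mulr0 subr0 expR0 hat0 /a /b.
by field.
Qed.

Lemma test_function_sphere z : sqnorm z.2 = 1 ->
  test_function z = (1 - e%:R) * time_cutoff l.+3 z.1.
Proof.
move=> z1; rewrite /test_function /radial z1 ln1 /space_profile /profile /mode /modes.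
by rewrite /cutoff !mul0r !mulr0 expR0 hat0; ring.
Qed.

Lemma Omega_sqnorm z : Omega z -> 0 < z.1 /\ 1 <= sqnorm z.2.
Proof.
move=> [/= + /negP]; rewrite in_itv/= andbT -leNgt /enorm => z1 z2; split => //.
rewrite -(@ler_sqrt _ _ _)//; first by rewrite sqrtr1.
by apply: sumr_ge0 => i _; exact: sqr_ge0.
Qed.

Lemma Omega_punctured : @Omega R n `<=` punctured.
Proof. by move=> z /Omega_sqnorm[_ z1]; rewrite /punctured /= (lt_le_trans _ z1). Qed.

Lemma Gamma_sqnorm z : Gamma z -> sqnorm z.2 = 1.
Proof. by move=> [_ z1]; rewrite -enorm_sqr (_ : enorm z.2 = 1)// expr1n. Qed.

Lemma test_function_ge0 z : Omega z -> 0 <= test_function z.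
Proof.
move=> /Omega_sqnorm[_ z1]; rewrite /test_function /radial mulr_ge0 ?hat_ge0//.
by rewrite mulr_ge0 ?hat_ge0// mode_ge0// ln_ge0.
Qed.

Definition cylinder : set (R * 'rV[R]_n) :=
  `[T, 3 * T]%classic `*` [set x | 1 <= sqnorm x <= expR S].

Lemma cylinder_Omega : cylinder `<=` @Omega R n.
Proof.
move=> z [/= + /andP[z1 _]]; rewrite in_itv/= => /andP[Tt _]; split => /=.
  by rewrite in_itv/= andbT (lt_le_trans horizon_gt0).
apply/negP; rewrite -leNgt /enorm -sqrtr1 ler_wsqrtr//.
Qed.

Lemma compact_cylinder : compact cylinder.
Proof.
apply: compact_setX; first exact: segment_compact.
set A := [set x | _].
have cA : closed A.
  rewrite (_ : A = (@sqnorm R n) @^-1` `[1, expR S]%classic); last first.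
    by apply/seteqP; split => x /=; rewrite in_itv.
  by apply: closed_comp => [x _|]; [exact: continuous_sqnorm|exact: itv_closed].
have cI : compact [set v : 'rV[R]_n |
    forall i, `[- expR (S / 2), expR (S / 2)]%classic (v ord0 i)].
  apply: (@rV_compact _ _ (fun=> `[- expR (S / 2), expR (S / 2)]%classic)).
  by move=> i; exact: segment_compact.
apply: subclosed_compact cA cI _ => x /andP[x1 xS] i.
rewrite /= in_itv/= -ler_norml (le_trans (coord_le_enorm _ _ _))//.
rewrite sqnorm_gt0_enorm ?(lt_le_trans _ x1)// ler_expR.
have : ln (sqnorm x) <= S by rewrite -[S]expRK ler_ln ?posrE ?expR_gt0// (lt_le_trans _ x1).
lra.
Qed.

Lemma cutoffs_eq0 j j' z : Omega z -> ~ cylinder z ->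
  time_cutoff j.+1 z.1 * cutoff S j'.+1 (ln (sqnorm z.2)) = 0.
Proof.
move=> /Omega_sqnorm[z0 z1] zK.
have [zT|zT] := boolP (T <= z.1 <= 3 * T); last by rewrite time_cutoff_eq0// mul0r.
rewrite mulrC /cutoff hat_eq0 ?mul0r// ler_normr.
have S0 : 0 < S := lt_le_trans ltr01 S_ge1.
rewrite ler_pdivlMr// mul1r -[leLHS]expRK ler_ln ?posrE ?expR_gt0//; last first.
  exact: lt_le_trans z1.
apply/orP; left; apply/negP => /negP; rewrite -ltNge => zS.
by apply: zK; split => /=; rewrite ?in_itv//= z1 ltW.
Qed.

Lemma supp_test_function : compactly_supported test_function.
Proof.
have ccl : closed cylinder := compact_closed (@norm_hausdorff _ _) compact_cylinder.
have sK : supp test_function `<=` cylinder.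
  rewrite /supp ((closure_id _).1 ccl); apply: closure_subset.
  move=> z [Oz /=]; apply: contraNP => zK; apply/eqP.
  rewrite /test_function /radial /space_profile /profile mulrCA.
  by rewrite cutoffs_eq0// mulr0.
split; last exact: subset_trans cylinder_Omega.
apply: subclosed_compact compact_cylinder sK; exact: closed_closure.
Qed.

End test_function.

(** * The pointwise estimate *)

Section pointwise.
Context {R : realType} {n : nat}.
Variables (k sigma p gamma : R) (e : bool) (l m : nat).
Hypothesis m_gt0 : (0 < m)%N.
Hypothesis nk_gt : 2 - n%:R < k.
Hypothesis sigma_gt : -2 < sigma.
Hypothesis p_gt1 : 1 < p.
Hypothesis gamma_inv : gamma = (p - 1)^-1.
Hypothesis gammaE : gamma = (n%:R + k - 2) / (sigma + 2).
Hypothesis gamma_le : 2 * gamma <= l.+1%:R.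

Let a := k / 2.
Let b : R := (n%:R - 2) / 2.
Let T : R := horizon m.
Let S : R := 2 * m%:R.
Let phi := @test_function R n k e l m.
Let s (z : R * 'rV[R]_n) := ln (sqnorm z.2).

Let m1 : 1 <= m%:R :> R. Proof. by rewrite ler1n. Qed.
Let S_ge1 : 1 <= S. Proof. by have := m1; rewrite /S; lra. Qed.
Let ab_gt0 : 0 < a + b. Proof. by have := nk_gt; rewrite /a /b; lra. Qed.

Definition truncation (z : R * 'rV[R]_n) : R :=
  hat 1 ((z.1 - 2 * T) / T) * hat 1 (s z / S).

Lemma truncation_itv z : 0 <= truncation z <= 1.
Proof. by rewrite mulr_ge0 ?hat_ge0//= mulr_ile1 ?hat_ge0 ?hat1_le1. Qed.

Lemma truncationX j z :
  truncation z ^+ j = time_cutoff m j z.1 * cutoff S j (s z).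
Proof. by rewrite exprMn -!hatE. Qed.

Lemma test_functionE z : phi z = mode a b e (s z) * truncation z ^+ l.+3.
Proof. by rewrite truncationX mulrCA. Qed.

(** The constant in the bound for both derivatives; it does not depend on [m]. *)
Definition rate : R := 2 * l.+3%:R + log_adjoint_bound a l n k.

Lemma log_adjoint_bound_ge0 : 0 <= log_adjoint_bound a l n k.
Proof. by rewrite /log_adjoint_bound !mulr_ge0// !addr_ge0// mulr_ge0// addr_ge0. Qed.

Lemma rate_gt0 : 0 < rate.
Proof. by rewrite /rate ltr_wpDr ?log_adjoint_bound_ge0// mulr_gt0. Qed.

(** Time and space derivatives have the same size by the choice of the horizon,
    and both lose at most two powers of the truncation. *)
Lemma derivatives_le z : Omega z ->
  `|partial_t phi z| + `|adjoint_operator k phi z| <=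
  mode a b e (s z) * (rate / m%:R * expR (- s z) * truncation z ^+ l.+1).
Proof.
move=> Oz; have [z0 z1] := Omega_sqnorm _ Oz.
have s0 : 0 <= s z by exact: ln_ge0.
have h0 := mode_ge0 a b e ab_gt0 _ s0.
have mp : 0 < m%:R :> R by exact: lt_le_trans m1.
have T0 : 0 < T := horizon_gt0 m m_gt0.
rewrite truncationX /phi partial_t_test_function adjoint_operator_test_function; last first.
  exact: Omega_punctured.
rewrite -/(s z) /space_profile /profile -/a -/b -/S.
set y := (z.1 - 2 * T) / T.
have cut0 j : 0 <= cutoff S j (s z) by exact: hat_ge0.
have tcut0 j : 0 <= time_cutoff m j z.1 by exact: hat_ge0.
have l13 : (l.+1 <= l.+3)%N by rewrite leqW.
have H1 : `|time_cutoff1 l m z.1 * (mode a b e (s z) * cutoff S l.+3 (s z))| <=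
    mode a b e (s z) * (2 * l.+3%:R / m%:R * expR (- s z) *
      (time_cutoff m l.+1 z.1 * cutoff S l.+1 (s z))).
  (* The bound on the horizon is available only inside the spatial support. *)
  have [sS|sS] := ltP S (s z).
    rewrite [cutoff S l.+3 _]hat_eq0; last first.
      by rewrite ler_normr ler_pdivlMr ?mul1r ?(ltW sS)// (lt_le_trans ltr01).
    by rewrite !mulr0 normr0 !mulr_ge0 ?expR_ge0// invr_ge0.
  rewrite normrM [X in _ * X]ger0_norm; last exact: mulr_ge0.
  rewrite [leLHS]mulrCA; apply: ler_wpM2l => //.
  rewrite [leRHS]mulrA; apply: ler_pM => //.
    have -> : time_cutoff1 l m z.1 = - (2 * l.+3%:R / T * (y * hat l.+2 y)).
      by rewrite /time_cutoff1 -/T -/y; ring.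
    rewrite normrN normrM [X in X * _]ger0_norm; last by rewrite divr_ge0// ltW.
    apply: ler_pM => //; first by rewrite divr_ge0// ltW.
      rewrite -[leRHS]mulrA ler_wpM2l// /T /horizon invfM ler_pM2l ?invr_gt0//.
      by rewrite -expRN ler_expR lerN2.
    rewrite normrM [X in _ * X]ger0_norm ?hat_ge0//.
    by apply: (le_trans (normM_hat_le _ _)); exact: hat_anti.
  exact: (hat_anti _ _ _ l13).
have H2 : `|time_cutoff m l.+3 z.1 * (log_adjoint a b e S l n k (s z) * expR (- s z))| <=
    mode a b e (s z) * (log_adjoint_bound a l n k / m%:R * expR (- s z) *
      (time_cutoff m l.+1 z.1 * cutoff S l.+1 (s z))).
  have H := log_adjoint_le a b e S l ab_gt0 S_ge1 n k erefl erefl _ s0.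
  rewrite normrM ger0_norm// normrM [X in _ * (_ * X)]ger0_norm ?expR_ge0//.
  apply: (@le_trans _ _ (time_cutoff m l.+1 z.1 * (log_adjoint_bound a l n k / m%:R *
    (mode a b e (s z) * cutoff S l.+1 (s z)) * expR (- s z)))).
    apply: ler_pM => //.
      exact: (hat_anti _ _ _ l13).
    apply: ler_wpM2r; first exact: expR_ge0.
    apply: (le_trans H); apply: ler_wpM2r; first exact: mulr_ge0.
    apply: ler_wpM2l; first exact: log_adjoint_bound_ge0.
    by rewrite lef_pV2 ?posrE ?mulr_gt0// /S ler_peMl ?ler1n.
  apply: ler_eq; ring.
apply: le_trans (lerD H1 H2) _.
apply: ler_eq; rewrite /rate; ring.
Qed.

(** Young's inequality with the weight [w = |x|^sigma] and
    [D = (rate / m) |x|^-2]; the remainder is bounded on the support by the shell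
    majorant, and outside the support the left-hand side vanishes. *)
Lemma absorption (u : R) z : Omega z ->
  `|u| * (`|partial_t phi z| + `|adjoint_operator k phi z|) <=
  z.1 `^ 0 * enorm z.2 `^ sigma * `|u| `^ p * phi z +
  (rate / m%:R) `^ (1 + gamma) * shell_majorant n T m z.
Proof.
move=> Oz; have [z0 z1] := Omega_sqnorm _ Oz.
have s0 : 0 <= s z by exact: ln_ge0.
have h0 := mode_ge0 a b e ab_gt0 _ s0.
have mp : 0 < m%:R :> R by exact: lt_le_trans m1.
have c0 : 0 < rate / m%:R by rewrite divr_gt0// rate_gt0.
have T0 : 0 < T := horizon_gt0 m m_gt0.
have zE : enorm z.2 = expR (s z / 2).
  by rewrite sqnorm_gt0_enorm// (lt_le_trans _ z1).
have /andP[t0 t1] := truncation_itv z.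
apply: le_trans (ler_wpM2l (normr_ge0 u) (derivatives_le z Oz)) _.
have [zK|zK] := pselect (cylinder m z); last first.
  rewrite [truncation z ^+ _]truncationX cutoffs_eq0// !mulr0.
  apply: addr_ge0.
    apply: mulr_ge0; last exact: test_function_ge0.
    by rewrite !mulr_ge0 ?powR_ge0.
  by rewrite mulr_ge0 ?powR_ge0// shell_majorant_ge0.
have sS : s z <= 2 * m%:R.
  case: zK => _ /= /andP[_ H].
  by rewrite -[leRHS]expRK ler_ln ?posrE ?expR_gt0// (lt_le_trans _ z1).
have tT : T <= z.1 <= 3 * T by case: zK => /=; rewrite in_itv.
set D := rate / m%:R * expR (- s z).
have D0 : 0 < D by rewrite mulr_gt0 ?expR_gt0.
set w := expR (s z / 2 * sigma).
have w0 : 0 < w by exact: expR_gt0.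
have Y := mul_le_absorb _ D w _ p gamma l (normr_ge0 u) D0 w0 (truncation_itv z)
  p_gt1 gamma_inv gamma_le.
have W := young_weight (s z) k sigma n%:R gamma _ _ sigma_gt gammaE c0
  (mode_le_expR a b e (s z)).
have M := le_shell_majorant n T m z (s z) zE tT m_gt0.
rewrite powRr0 mul1r zE -expRM -/w test_functionE.
apply: (@le_trans _ _ (mode a b e (s z) * (`|u| * D * truncation z ^+ l.+1))).
  apply: ler_eq; ring.
apply: le_trans (ler_wpM2l h0 Y) _.
rewrite mulrDr; apply: lerD.
  apply: ler_eq; ring.
apply: le_trans W _; apply: ler_wpM2l; first exact: powR_ge0.
by apply: M; rewrite s0.
Qed.

End pointwise.

(** * Integrated estimate *)

Section integrability.
Context {R : realType} {n : nat}.

Local Notation ST := (measurableTypeR R * 'rV[R]_n)%type.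

Lemma measurable_sqnorm : measurable_fun [set: 'rV[R]_n] (@sqnorm R n).
Proof.
by apply: measurable_sum => i; apply: measurable_funX; exact: measurable_coord.
Qed.

Lemma measurable_radial (eta G : R -> R) :
  measurable_fun [set: R] eta -> measurable_fun [set: R] G ->
  measurable_fun [set: ST] (radial eta G).
Proof.
move=> meta mG; apply: measurable_funM.
  exact: (measurableT_comp meta measurable_fst).
apply: (measurableT_comp mG).
exact: (measurableT_comp measurable_sqnorm measurable_snd).
Qed.

Lemma measurable_Omega : measurable (@Omega R n : set ST).
Proof.
apply: measurableX => //; apply: measurableC; exact: measurable_unit_ball.
Qed.

Lemma measurable_cylinder m : measurable (@cylinder R n m : set ST).
Proof.
apply: measurableX => //.
rewrite (_ : [set x | _] = (@sqnorm R n) @^-1` `[1, expR (2 * m%:R)]%classic); last first.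
  by apply/seteqP; split => x /=; rewrite in_itv.
by rewrite -[X in measurable X]setTI; exact: measurable_sqnorm.
Qed.

Variables (k sigma p gamma : R) (e : bool) (l m : nat).
Hypothesis m_gt0 : (0 < m)%N.
Hypothesis nk_gt : 2 - n%:R < k.
Hypothesis sigma_gt : -2 < sigma.
Hypothesis p_gt1 : 1 < p.
Hypothesis gamma_inv : gamma = (p - 1)^-1.
Hypothesis gammaE : gamma = (n%:R + k - 2) / (sigma + 2).
Hypothesis gamma_le : 2 * gamma <= l.+1%:R.

Let T : R := horizon m.
Let S : R := 2 * m%:R.
Let phi := @test_function R n k e l m.

Variable u : R * 'rV[R]_n -> R.
Hypothesis uLp : Lp_loc p u.

Let mu := @dtdx R n.
Let A z := z.1 `^ 0 * enorm z.2 `^ sigma * `|u z| `^ p * phi z.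

Let mu_u : measurable_fun (@Omega R n : set ST) u.
Proof. by case: uLp. Qed.

Lemma measurable_space_profile :
  measurable_fun [set: R] (fun q => @space_profile R n k e l m (ln q)).
Proof.
apply: measurableT_comp (@measurable_ln R).
apply: continuous_measurable_fun => x; apply: differentiable_continuous.
by apply/derivable1_diffP; have [] := is_derive_profile (k / 2) ((n%:R - 2) / 2) e S l x.
Qed.

Lemma measurable_test_function : measurable_fun [set: ST] phi.
Proof.
apply: measurable_radial; last exact: measurable_space_profile.
by apply: continuous_measurable_fun; exact: continuous_time_cutoff.
Qed.

Lemma measurable_partial_t : measurable_fun [set: ST] (partial_t phi).
Proof.
rewrite (_ : partial_t phi = radial (time_cutoff1 l m)
   (fun q => @space_profile R n k e l m (ln q))); last first.
  by apply/funext => z; rewrite partial_t_test_function.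
apply: measurable_radial; last exact: measurable_space_profile.
by apply: continuous_measurable_fun; exact: continuous_time_cutoff1.
Qed.

Lemma measurable_adjoint_operator :
  measurable_fun (@Omega R n : set ST) (adjoint_operator k phi).
Proof.
pose g s := log_adjoint (k / 2) ((n%:R - 2) / 2) e S l n k s * expR (- s).
suff H : measurable_fun [set: ST] (radial (time_cutoff m l.+3) (fun q => g (ln q))).
  have H' : measurable_fun (@Omega R n : set ST)
      (radial (time_cutoff m l.+3) (fun q => g (ln q))).
    exact: measurable_funS H.
  apply: eq_measurable_fun H' => z; rewrite inE => /Omega_punctured zp.
  by rewrite /phi adjoint_operator_test_function.
apply: measurable_radial.
  by apply: continuous_measurable_fun; exact: continuous_time_cutoff.
apply: measurableT_comp (@measurable_ln R).
have cd (f f1 : R -> R) : (forall x : R, is_derive x 1 f (f1 x)) -> measurable_fun setT f.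
  move=> df; apply: continuous_measurable_fun => x.
  by apply: differentiable_continuous; apply/derivable1_diffP; have [] := df x.
apply: measurable_funM; last first.
  by apply: (measurableT_comp (@measurable_expR R)); exact: oppr_measurable.
apply: measurable_funD; [apply: measurable_funD|]; apply: measurable_funM => //.
- apply: continuous_measurable_fun; exact: continuous_profile2.
- exact: (cd _ _ (is_derive_profile1 (k / 2) ((n%:R - 2) / 2) e S l)).
- exact: (cd _ _ (is_derive_profile (k / 2) ((n%:R - 2) / 2) e S l)).
Qed.

Lemma measurable_absorbing_term : measurable_fun (@Omega R n : set ST) A.
Proof.
apply: measurable_funM; last exact: (measurable_funS _ _ measurable_test_function).
apply: measurable_funM; last first.
  apply: (measurableT_comp (measurable_powR p)).
  exact: (measurableT_comp (@normr_measurable R setT) mu_u).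
under eq_fun do rewrite powRr0 mul1r.
apply: (@measurable_funS _ _ _ _ setT) => //.
apply: (measurableT_comp (measurable_powR sigma)).
exact: (measurableT_comp (@measurable_enorm R n) measurable_snd).
Qed.

Lemma absorbing_term_ge0 z : Omega z -> 0 <= A z.
Proof.
move=> Oz; apply: mulr_ge0; last exact: test_function_ge0.
by rewrite !mulr_ge0 ?powR_ge0.
Qed.

Lemma absorbing_term_le z : cylinder m z ->
  A z <= expR (m%:R * `|sigma|) * expR (m%:R * `|k|) * `|u z| `^ p.
Proof.
move=> zK; have Oz := cylinder_Omega m m_gt0 _ zK.
have [z0 z1] := Omega_sqnorm _ Oz.
have s0 : 0 <= ln (sqnorm z.2) by exact: ln_ge0.
have sm : ln (sqnorm z.2) / 2 <= m%:R.
  have [_ /= /andP[_ H]] := zK.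
  rewrite ler_pdivrMr// [leRHS]mulrC.
  by rewrite -[leRHS]expRK ler_ln ?posrE ?expR_gt0// (lt_le_trans _ z1).
have le_m (c : R) : ln (sqnorm z.2) / 2 * c <= m%:R * `|c|.
  apply: (@le_trans _ _ (ln (sqnorm z.2) / 2 * `|c|)).
    by rewrite ler_wpM2l ?divr_ge0// ler_norm.
  by rewrite ler_wpM2r.
have hp : phi z <= expR (m%:R * `|k|).
  have hat1 j (y : R) : hat j y <= 1.
    by rewrite hatE exprn_ile1 ?hat_ge0 ?hat1_le1.
  rewrite /phi /test_function /radial /space_profile /profile.
  apply: (@le_trans _ _ (mode (k / 2) ((n%:R - 2) / 2) e (ln (sqnorm z.2)))).
    rewrite mulrCA ler_piMr//.
      by apply: mode_ge0 => //; have := nk_gt; lra.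
    by rewrite mulr_ile1 ?hat_ge0 ?hat1.
  apply: (le_trans (mode_le_expR _ _ _ _)); rewrite ler_expR.
  by apply: le_trans (le_m k); apply: ler_eq; ring.
rewrite /A powRr0 mul1r [leRHS]mulrAC; apply: ler_pM => //.
- by rewrite mulr_ge0 ?powR_ge0.
- exact: test_function_ge0.
apply: ler_wpM2r; first exact: powR_ge0.
rewrite sqnorm_gt0_enorm ?(lt_le_trans _ z1)// -expRM ler_expR; exact: le_m.
Qed.

Lemma absorbing_term_eq0 z : Omega z -> ~ cylinder m z -> A z = 0.
Proof.
move=> Oz zK; rewrite /A /phi /test_function /radial /space_profile /profile.
by rewrite [time_cutoff _ _ _ * _]mulrCA cutoffs_eq0// !mulr0.
Qed.

Lemma integrable_absorbing_term : mu.-integrable (@Omega R n : set ST) (EFin \o A).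
Proof.
pose c := expR (m%:R * `|sigma|) * expR (m%:R * `|k|).
have c0 : 0 <= c by rewrite mulr_ge0 ?expR_ge0.
have KO : (@cylinder R n m : set ST) `<=` @Omega R n by exact: cylinder_Omega.
have mK := measurable_cylinder m.
have mup : measurable_fun (@cylinder R n m : set ST) (fun z => `|u z| `^ p).
  apply: (measurable_funS measurable_Omega KO).
  apply: (measurableT_comp (measurable_powR p)).
  exact: (measurableT_comp (@normr_measurable R setT) mu_u).
have iK : mu.-integrable (@cylinder R n m : set ST) (fun z => (`|u z| `^ p)%:E).
  apply/integrableP; split; first exact/measurable_EFinP.
  under eq_integral do rewrite gee0_abs ?lee_fin ?powR_ge0//.
  by case: uLp => _ /(_ _ (compact_cylinder m) KO).
have icK := integrableZl mK c iK.
have iO := (integrable_mkcond _ mK).1 icK.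
have {}iO := integrableS measurableT measurable_Omega (@subsetT _ _) iO.
apply: (le_integrable measurable_Omega _ _ iO).
  by apply/measurable_EFinP; exact: measurable_absorbing_term.
move=> z Oz /=; rewrite patchE; case: ifPn => [|]; last first.
  rewrite notin_setE => zK.
  by rewrite absorbing_term_eq0// normr0 abse_ge0.
rewrite inE => zK; rewrite lee_fin [leLHS]ger0_norm; last exact: absorbing_term_ge0.
apply: (le_trans (absorbing_term_le _ zK)).
by rewrite ger0_norm// mulr_ge0// powR_ge0.
Qed.

Let T0 : 0 < T := horizon_gt0 m m_gt0.

Lemma integrable_shell_majorant :
  mu.-integrable (@Omega R n : set ST) (EFin \o shell_majorant n T m).
Proof.
apply: (integrableS measurableT measurable_Omega (@subsetT _ _)).
apply/integrableP; split.
  by apply/measurable_EFinP; exact: measurable_shell_majorant.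
under eq_integral do rewrite gee0_abs ?lee_fin ?shell_majorant_ge0//.
by rewrite integral_shell_majorant// ltry.
Qed.

Lemma Rintegral_shell_majorant_le :
  \int[mu]_(z in @Omega R n) shell_majorant n T m z
  <= m%:R * (2 * T * (2 * expR 1) ^+ n).
Proof.
rewrite -[leRHS]/(fine (_%:E)) -integral_shell_majorant//.
apply: fine_le.
- exact: (integrable_fin_num measurable_Omega integrable_shell_majorant).
- by rewrite integral_shell_majorant.
apply: ge0_subset_integral => //.
- exact: measurable_Omega.
- by apply/measurable_EFinP; exact: measurable_shell_majorant.
- by move=> z _; rewrite lee_fin shell_majorant_ge0.
Qed.

Let c := (rate (n := n) k l / m%:R) `^ (1 + gamma).

(** The pointwise absorption bounds the terms linear in [u] by an integrable
    function, which makes them integrable as well. *)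
Lemma integrable_dominated (F : R * 'rV[R]_n -> R) :
  measurable_fun (@Omega R n : set ST) F ->
  (forall z, Omega z -> `|F z| <= A z + c * shell_majorant n T m z) ->
  mu.-integrable (@Omega R n : set ST) (EFin \o F).
Proof.
move=> mF Fle.
have H := integrableD measurable_Omega integrable_absorbing_term
  (integrableZl measurable_Omega c integrable_shell_majorant).
apply: (le_integrable measurable_Omega _ _ H); first exact/measurable_EFinP.
by move=> z Oz /=; rewrite lee_fin (le_trans (Fle _ Oz))// ler_norm.
Qed.

(** The right-hand side of the weak inequality exceeds the nonlinear term by at
    most the integral of the remainder. *)
Lemma weak_rhs_le :
  - (\int[mu]_(z in @Omega R n) (u z * partial_t phi z)) +
  \int[mu]_(z in @Omega R n) (adjoint_operator k phi z * u z)
  <= \int[mu]_(z in @Omega R n) A z + c * (m%:R * (2 * T * (2 * expR 1) ^+ n)).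
Proof.
have ab z (Oz : Omega z) := absorption k sigma p gamma e l m m_gt0 nk_gt sigma_gt
  p_gt1 gamma_inv gammaE gamma_le (u z) z Oz.
have i1 : mu.-integrable (@Omega R n : set ST) (EFin \o (fun z => u z * partial_t phi z)).
  apply: integrable_dominated.
    by apply: measurable_funM => //; exact: (measurable_funS _ _ measurable_partial_t).
  move=> z Oz; apply: le_trans (ab z Oz).
  by rewrite normrM ler_wpM2l// lerDl.
have i2 : mu.-integrable (@Omega R n : set ST)
    (EFin \o (fun z => adjoint_operator k phi z * u z)).
  apply: integrable_dominated.
    by apply: measurable_funM => //; exact: measurable_adjoint_operator.
  move=> z Oz; apply: le_trans (ab z Oz).
  by rewrite normrM mulrC ler_wpM2l// lerDr.
rewrite addrC -RintegralB//; last exact: measurable_Omega.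
have iM := integrableZl measurable_Omega c integrable_shell_majorant.
apply: (@le_trans _ _ (\int[mu]_(z in @Omega R n) (A z + c * shell_majorant n T m z))).
  apply: le_Rintegral.
  - exact: measurable_Omega.
  - exact: (integrableB measurable_Omega i2 i1).
  - exact: (integrableD measurable_Omega integrable_absorbing_term iM).
  move=> z Oz; apply: le_trans (ab z Oz).
  apply: (le_trans (ler_norm _)); apply: (le_trans (ler_normB _ _)).
  by rewrite !normrM mulrDr addrC [X in _ + X]mulrC.
rewrite RintegralD//; last 2 first.
- exact: measurable_Omega.
- exact: integrable_absorbing_term.
rewrite lerD2l RintegralZl//; last 2 first.
- exact: measurable_Omega.
- exact: integrable_shell_majorant.
by rewrite ler_wpM2l ?powR_ge0// Rintegral_shell_majorant_le.
Qed.

End integrability.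

(** * The boundary term *)

Section boundary.
Context {R : realType}.

Lemma Rintegral_tensor d1 d2 (T1 : measurableType d1) (T2 : measurableType d2)
    (m1 : {sigma_finite_measure set T1 -> \bar R})
    (m2 : {sigma_finite_measure set T2 -> \bar R}) (g : T1 -> R) (f : T2 -> R) :
  m1.-integrable setT (EFin \o g) -> m2.-integrable setT (EFin \o f) ->
  \int[(m1 \x m2)%E]_z (g z.1 * f z.2) = (\int[m1]_t g t) * (\int[m2]_x f x).
Proof.
move=> ig jf.
have mg : measurable_fun setT g by apply/measurable_EFinP; exact: measurable_int ig.
have mf : measurable_fun setT f by apply/measurable_EFinP; exact: measurable_int jf.
have mF : measurable_fun setT (fun z : T1 * T2 => (g z.1 * f z.2)%:E).
  apply/measurable_EFinP; apply: measurable_funM.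
    exact: (measurableT_comp mg measurable_fst).
  exact: (measurableT_comp mf measurable_snd).
have iF : (m1 \x m2)%E.-integrable setT (fun z : T1 * T2 => (g z.1 * f z.2)%:E).
  apply/integrable12ltyP => //=.
  under eq_integral => t _.
    under eq_integral do rewrite normrM EFinM.
    rewrite ge0_integralZl_EFin//; last first.
      by apply/measurable_EFinP; exact: (measurableT_comp (@normr_measurable R setT) mf).
    over.
  have fabs : (\int[m2]_x `|f x|%:E < +oo)%E by case/integrableP: jf.
  have gabs : (\int[m1]_t `|g t|%:E < +oo)%E by case/integrableP: ig.
  have f0 : (0 <= \int[m2]_x `|f x|%:E)%E by apply: integral_ge0 => x _; rewrite lee_fin.
  have g0 : (0 <= \int[m1]_t `|g t|%:E)%E by apply: integral_ge0 => x _; rewrite lee_fin.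
  have ff : (\int[m2]_x `|f x|%:E)%E \is a fin_num by rewrite ge0_fin_numE.
  rewrite -(fineK ff) ge0_integralZr//.
  - by rewrite fineK// lte_mul_pinfty// ge0_fin_numE.
  - by apply/measurable_EFinP; exact: (measurableT_comp (@normr_measurable R setT) mg).
  - exact: fine_ge0.
have ff : (\int[m2]_x (f x)%:E)%E \is a fin_num by exact: integrable_fin_num.
have gf : (\int[m1]_t (g t)%:E)%E \is a fin_num by exact: integrable_fin_num.
rewrite /Rintegral -(integral12_prod_meas1 iF) /fubini_F /=.
under eq_integral => t _.
  under eq_integral do rewrite EFinM.
  rewrite integralZl//.
  over.
by rewrite -(fineK ff) integralZr// fineM.
Qed.

Variables (m l : nat).
Hypothesis m_gt0 : (0 < m)%N.
Let T : R := horizon m.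
Let T0 : 0 < T := horizon_gt0 m m_gt0.
Let tau : R -> R := time_cutoff m l.+1.

Lemma integrable_time_cutoff :
  (@lebesgue_measure R).-integrable setT (EFin \o tau).
Proof.
have H := integrable_indic_itv T (3 * T) true false.
apply: (le_integrable measurableT _ _ H).
  apply/measurable_EFinP; apply: continuous_measurable_fun.
  exact: continuous_time_cutoff.
move=> t _ /=; rewrite lee_fin indicE.
have [tI|tI] := boolP (T <= t <= 3 * T).
  rewrite mem_set ?normr1/= ?in_itv//= ger0_norm ?hat_ge0//.
  by rewrite /tau /time_cutoff hatE exprn_ile1 ?hat_ge0 ?hat1_le1.
by rewrite /tau time_cutoff_eq0// normr0.
Qed.

(** On the middle half of its support the parabola is at least [3 / 4]. *)
Lemma Rintegral_time_cutoff_ge :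
  T * (3 / 4) ^+ l.+1 <= \int[@lebesgue_measure R]_t tau t.
Proof.
pose I := `[3 / 2 * T, 5 / 2 * T]%classic.
have iI := integrable_indic_itv (3 / 2 * T) (5 / 2 * T) true false.
have -> : T * (3 / 4) ^+ l.+1 = \int[@lebesgue_measure R]_t ((3 / 4) ^+ l.+1 * \1_I t).
  rewrite RintegralZl// mulrC; congr (_ * _).
  rewrite /Rintegral integral_indic//; last exact: measurable_itv.
  have -> : I `&` [set: measurableTypeR R] = I by exact: setIT.
  rewrite /= lebesgue_measure_itv/= lte_fin.
  rewrite ifT /=; last by have := T0; lra.
  lra.
apply: le_Rintegral => //.
- exact: (integrableZl measurableT ((3 / 4) ^+ l.+1) iI).
- exact: integrable_time_cutoff.
move=> t _; rewrite indicE.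
have [|] := boolP (t \in I); last by rewrite mulr0 hat_ge0.
rewrite inE /I /= in_itv/= => /andP[t1 t2].
rewrite mulr1 /tau /time_cutoff hatE ler_pXn2r ?nnegrE ?hat_ge0//.
rewrite /hat expr1 le_max; apply/orP; right.
rewrite lerBrDr -lerBrDl.
have -> : (1 - 3 / 4 : R) = (1 / 2) ^+ 2 by field.
rewrite -[leLHS]real_normK ?num_real// ler_pXn2r ?nnegrE//.
rewrite ler_norml ler_pdivrMr// ler_pdivlMr// -/T.
by have := T0; move=> ?; apply/andP; split; lra.
Qed.

Variables (n : nat) (f : 'rV[R]_n -> R).
Hypothesis f_L1 : (@surface_measure R n).-integrable (@unit_sphere R n) (fun x => (f x)%:E).

Lemma Rintegral_Gamma :
  \int[@dtdS R n]_(z in @Gamma R n) (f z.2 * tau z.1) =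
  (\int[@lebesgue_measure R]_t tau t) *
  \int[@surface_measure R n]_(x in @unit_sphere R n) f x.
Proof.
rewrite Rintegral_mkcond [X in _ * X]Rintegral_mkcond.
have H : (@surface_measure R n).-integrable setT (EFin \o (f \_ (@unit_sphere R n))).
  have := (integrable_mkcond _ (@measurable_unit_sphere R n)).1 f_L1.
  by apply: eq_integrable => // x _; rewrite /= !patchE; case: ifP.
have := Rintegral_tensor _ _ _ _ (@lebesgue_measure R) (@surface_measure R n) _ _
  integrable_time_cutoff H.
move=> <-; congr (fine _); apply: eq_integral => z _; congr EFin.
(* Off Gamma either f is cut to 0 or the time is nonpositive and the time
   cutoff vanishes. *)
rewrite !patchE; case: ifPn => [|].
  by rewrite inE => -[_ z2]; rewrite mem_set// mulrC.
rewrite notin_setE /Gamma /= => zG.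
case: ifPn; last by rewrite mulr0.
rewrite inE => z2; rewrite /tau time_cutoff_eq0 ?mul0r//.
apply/negP => /andP[Tz _]; apply: zG; split => //=.
by rewrite in_itv/= andbT (lt_le_trans T0).
Qed.

End boundary.

(** * Nonexistence *)

Lemma powR_decay_absurd {R : realType} (r gamma K L : R) :
  0 < r -> 0 < gamma -> 0 < K -> 0 <= L ->
  (forall m, (0 < m)%N -> K <= (r / m%:R) `^ (1 + gamma) * m%:R * L) -> False.
Proof.
move=> r0 g0 K0 L0 H.
pose d := (K / (2 * (r * L + 1))) `^ gamma^-1.
have L1 : 0 < r * L + 1 by rewrite ltr_wpDl// mulr_ge0// ltW.
have q0 : 0 < K / (2 * (r * L + 1)) by rewrite divr_gt0 ?mulr_gt0.
have d0 : 0 < d by rewrite powR_gt0.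
pose m := (Num.truncn (r / d)).+1.
have mp : 0 < m%:R :> R by [].
have rm : r / m%:R <= d.
  by rewrite ler_pdivrMr// mulrC -ler_pdivrMr// ltW// truncnS_gt.
have x0 : 0 < r / m%:R by rewrite divr_gt0.
have := H m isT; apply/negP; rewrite -ltNge.
have -> : (r / m%:R) `^ (1 + gamma) = r / m%:R * (r / m%:R) `^ gamma.
  by rewrite powRD ?powRr1 ?(ltW x0)//; apply/implyP => _; rewrite gt_eqF.
have -> : r / m%:R * (r / m%:R) `^ gamma * m%:R * L = r * L * (r / m%:R) `^ gamma.
  by field; rewrite gt_eqF.
have le1 : (r / m%:R) `^ gamma <= K / (2 * (r * L + 1)).
  have -> : K / (2 * (r * L + 1)) = d `^ gamma.
    by rewrite /d -powRrM mulVf ?gt_eqF// powRr1// ltW.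
  by apply: (ge0_ler_powR (ltW g0)) => //; rewrite nnegrE ltW.
have rL : 0 <= r * L by rewrite mulr_ge0// ltW.
apply: (le_lt_trans (ler_wpM2l rL le1)).
rewrite mulrA ltr_pdivrMr ?mulr_gt0//.
have : r * L * K <= (r * L + 1) * K by rewrite ler_wpM2r ?(ltW K0)// lerDl.
have : 0 < (r * L + 1) * K by rewrite mulr_gt0.
move=> ? ?; nra.
Qed.

Section nonexistence.
Context {R : realType} {n : nat}.
Variables (k sigma p : R) (f : 'rV[R]_n -> R).
Hypothesis f_L1 : (@surface_measure R n).-integrable (@unit_sphere R n) (fun x => (f x)%:E).
Hypothesis If_gt0 : 0 < \int[@surface_measure R n]_(x in @unit_sphere R n) f x.
Hypothesis sigma_gt : -2 < sigma.
Hypothesis k_gt : 2 - n%:R < k.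
Hypothesis p_eq : p = 1 + (sigma + 2) / (n%:R + k - 2).

(** Common end of both problems: [kappa] is the factor with which the flux of
    [f] enters, [1] for the Neumann-type and [n + k - 2] for the Dirichlet-type
    condition.  Dividing by the horizon leaves a quantity decaying like
    [m^-gamma] above a positive constant. *)
Lemma no_test_family (e : bool) (kappa : R) (u : R * 'rV[R]_n -> R) :
  0 < kappa -> Lp_loc p u ->
  ~ (forall l m, (0 < m)%N ->
    \int[@dtdx R n]_(z in @Omega R n)
       (z.1 `^ 0 * enorm z.2 `^ sigma * `|u z| `^ p * test_function k e l m z) +
    kappa * \int[@dtdS R n]_(z in @Gamma R n) (f z.2 * time_cutoff m l.+3 z.1)
    <= - (\int[@dtdx R n]_(z in @Omega R n) (u z * partial_t (test_function k e l m) z)) +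
       \int[@dtdx R n]_(z in @Omega R n) (adjoint_operator k (test_function k e l m) z * u z)).
Proof.
move=> kappa0 uLp H.
have d0 : 0 < n%:R + k - 2 by have := k_gt; lra.
have s0 : 0 < sigma + 2 by have := sigma_gt; lra.
pose gamma := (n%:R + k - 2) / (sigma + 2).
have g0 : 0 < gamma by rewrite divr_gt0.
have p1 : 1 < p by rewrite p_eq ltrDl divr_gt0.
have gp : gamma = (p - 1)^-1 by rewrite p_eq addrC addKr invf_div.
pose l := Num.truncn (2 * gamma).
have lg : 2 * gamma <= l.+1%:R by rewrite ltW// truncnS_gt.
pose If := \int[@surface_measure R n]_(x in @unit_sphere R n) f x.
apply: (@powR_decay_absurd R (rate (n := n) k l) gamma (kappa * ((3 / 4) ^+ l.+3 * If))
  (2 * (2 * expR 1) ^+ n)) => //.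
- exact: rate_gt0.
- by apply: mulr_gt0 => //; apply: mulr_gt0 => //; exact: exprn_gt0.
move=> m m0.
have T0 := @horizon_gt0 R m m0.
have W := weak_rhs_le k sigma p gamma e l m m0 k_gt sigma_gt p1 gp erefl lg u uLp.
have := le_trans (H l m m0) W.
rewrite lerD2l Rintegral_Gamma// => B.
have J := @Rintegral_time_cutoff_ge R m l.+2 m0.
have B' := le_trans (ler_wpM2l (ltW kappa0) (ler_wpM2r (ltW If_gt0) J)) B.
rewrite -(ler_pM2l T0) -/If.
move: B'; rewrite -/If; set c := _ `^ _; set E := _ ^+ n; set q := _ ^+ l.+3; set T := horizon m.
move=> B'.
rewrite [leLHS](_ : _ = kappa * (T * q * If)); last by ring.
by apply: (le_trans B'); apply: ler_eq; ring.
Qed.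

End nonexistence.

Theorem theorem1p7 (R : realType) (N : nat) (k sigma alpha p : R)
    (f : 'rV[R]_N -> R)
    (N_ge2 : (2 <= N)%N)
    (f_L1 : (@surface_measure R N).-integrable (@unit_sphere R N)
              (fun x => (f x)%:E))
    (I_f_gt0 : 0 < \int[@surface_measure R N]_(x in @unit_sphere R N) f x)
    (alpha_eq0 : alpha = 0)
    (sigma_gt : -2 < sigma)
    (k_gt : 2 - N%:R < k)
    (p_eq : p = 1 + (sigma + 2) / (N%:R + k - 2)) :
  ~ (exists u : R * 'rV[R]_N -> R, neumann_weak_solution alpha sigma k p f u) /\
  ~ (exists u : R * 'rV[R]_N -> R, dirichlet_weak_solution alpha sigma k p f u).
Proof.
have C12t e l m : C12 (@test_function R N k e l m).
  exists (@punctured R N); split; [exact: open_punctured|exact: Omega_punctured|].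
  exact: C12_test_function.
subst alpha; split=> -[u [uLp H]].
- apply: (no_test_family k sigma p f f_L1 I_f_gt0 sigma_gt k_gt p_eq false 1 u ltr01 uLp).
  move=> l m m0.
  have := H (test_function k false l m); rewrite mul1r.
  have -> : \int[@dtdS R N]_(z in @Gamma R N) (f z.2 * test_function k false l m z) =
      \int[@dtdS R N]_(z in @Gamma R N) (f z.2 * time_cutoff m l.+3 z.1).
    apply: eq_Rintegral => z; rewrite inE => /Gamma_sqnorm z1.
    by rewrite test_function_sphere//=; ring.
  apply; split.
  + exact: C12t.
  + by move=> z; exact: test_function_ge0.
  + exact: supp_test_function.
  move=> z /Gamma_sqnorm z1.
  by rewrite normal_derivative_test_function// test_function_sphere//=; ring.
- have d0 : 0 < N%:R + k - 2 by lra.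
  apply: (no_test_family k sigma p f f_L1 I_f_gt0 sigma_gt k_gt p_eq true _ u d0 uLp).
  move=> l m m0.
  have := H (test_function k true l m).
  (* The constant is moved into the datum so that the boundary integral is
     again of the form treated above. *)
  pose g (x : 'rV[R]_N) := - (N%:R + k - 2) * f x.
  have g_L1 : (@surface_measure R N).-integrable (@unit_sphere R N) (fun x => (g x)%:E).
    exact: (integrableZl (@measurable_unit_sphere R N) _ f_L1).
  have -> : \int[@dtdS R N]_(z in @Gamma R N)
        (f z.2 * normal_derivative (test_function k true l m) z) =
      \int[@dtdS R N]_(z in @Gamma R N) (g z.2 * time_cutoff m l.+3 z.1).
    apply: eq_Rintegral => z; rewrite inE => /Gamma_sqnorm z1.
    by rewrite normal_derivative_test_function//= /g; ring.
  rewrite !Rintegral_Gamma// RintegralZl//; last exact: measurable_unit_sphere.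
  set I := \int[_]_(x in _) f x; set J := \int[_]_t _.
  rewrite (_ : - (J * (- (N%:R + k - 2) * I)) = (N%:R + k - 2) * (J * I)); last by ring.
  apply; split.
  + exact: C12t.
  + by move=> z; exact: test_function_ge0.
  + exact: supp_test_function.
  + by move=> z /Gamma_sqnorm z1; rewrite test_function_sphere//= subrr mul0r.
  + move=> z /Gamma_sqnorm z1; rewrite normal_derivative_test_function//=.
    rewrite mulNr oppr_le0 mulr_ge0 ?hat_ge0//; lra.
Qed.
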